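(* Let $c>\mathcal{J}^\star$ and $\tau_0<1$ be such that $\tau(\mathbf{K})\le\tau_0$ for every $\mathbf{K}\in\mathcal{G}_c\setminus\{\mathbf{K}^\star\}$, and set $\mu=4(1-\tau_0)\,\lambda_{\min}(G_w)\,\lambda_{\min}(\Sigma_0)\,\lambda_{\min}(R)$. There exists $\bar\eta>0$, depending only on $\mathcal{G}_c$ and a compact neighborhood of it (in particular not on the initial point), such that for every $\mathbf{K}^{(0)}\in\mathcal{G}_c$ and every $\eta\in(0,\bar\eta]$ the iteration $\mathbf{K}^{(t+1)}=\mathbf{K}^{(t)}-\eta\,\nabla\mathcal{J}(\mathbf{K}^{(t)})$, $t=0,1,2,\dots$, remains in $\mathcal{G}_c$ and satisfies, for all $t\ge0$, $$\mathcal{J}(\mathbf{K}^{(t)})-\mathcal{J}^\star \le \Big(1-\frac{\eta\mu}{2}\Big)^{t}\big(\mathcal{J}(\mathbf{K}^{(0)})-\mathcal{J}^\star\big),$$ and $\mathbf{K}^{(t)}\to\mathbf{K}^\star$ as $t\to\infty$.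
   Context: Setting. $\{\rho_1,\dots,\rho_S\}$ is a finite grid with weights $\nu_s>0$, $\sum_{s=1}^S\nu_s=1$. $w_1,\dots,w_N$ are continuous weighting functions with $w_i(\rho)\ge 0$ and $\sum_{i=1}^N w_i(\rho)=1$; $A(\rho)=\sum_i w_i(\rho)A_i$ and $B(\rho)=\sum_i w_i(\rho)B_i$ with $A_i\in\mathbb{R}^{n\times n}$, $B_i\in\mathbb{R}^{n\times m}$. The matrices $Q,\Sigma_0\in\mathbb{R}^{n\times n}$ and $R\in\mathbb{R}^{m\times m}$ are symmetric positive definite. A gain $K\in\mathbb{R}^{m\times n}$ stabilizes plant $s$ if $A_{\mathrm{cl}}=A(\rho_s)-B(\rho_s)K$ is Schur stable (spectral radius $<1$). For such $K$: $P$ is the solution of $P=A_{\mathrm{cl}}^\top P A_{\mathrm{cl}}+Q+K^\top RK$; $\Sigma$ is the solution of $\Sigma=A_{\mathrm{cl}}\Sigma A_{\mathrm{cl}}^\top+\Sigma_0$; $J_s(K)=\operatorname{tr}(P\Sigma_0)$; $H=R+B(\rho_s)^\top PB(\rho_s)$; $E=HK-B(\rho_s)^\top PA(\rho_s)$. A schedule is a tuple $\mathbf{K}=(K_1,\dots,K_N)$ of matrices in $\mathbb{R}^{m\times n}$; its deployed gain at grid point $s$ is $K_{\mathbf{K}}(\rho_s)=\sum_i w_i(\rho_s)K_i$. The feasible set is the open set $\mathcal{K}=\{\mathbf{K}: K_{\mathbf{K}}(\rho_s)\text{ stabilizes plant } s,\ s=1,\dots,S\}$, and the scheduled cost is $\mathcal{J}(\mathbf{K})=\sum_s\nu_s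 J_s(K_{\mathbf{K}}(\rho_s))$ on $\mathcal{K}$. Write $P_s,\Sigma_s,E_s,H_s$ for the matrices $P,\Sigma,E,H$ of plant $s$ at the deployed gain $K=K_{\mathbf{K}}(\rho_s)$. The gradient $\nabla\mathcal{J}(\mathbf{K})$ has blocks $\nabla_{K_i}\mathcal{J}(\mathbf{K})=2\sum_s\nu_s w_i(\rho_s)E_s\Sigma_s$. Standing assumptions: $\mathcal{K}\ne\emptyset$ and $G_w=\sum_s\nu_s w(\rho_s)w(\rho_s)^\top\succ0$, where $w(\rho)=(w_1(\rho),\dots,w_N(\rho))^\top$. Under these, $\mathcal{J}$ attains its minimum over $\mathcal{K}$; $\mathbf{K}^\star\in\mathcal{K}$ denotes a fixed minimizer, $\mathcal{J}^\star=\mathcal{J}(\mathbf{K}^\star)$, and $\Sigma_s^\star$ is the covariance $\Sigma$ of plant $s$ at the gain $K_{\mathbf{K}^\star}(\rho_s)$. The inner product is $\langle X,Y\rangle=\operatorname{tr}(X^\top Y)$, summed over the tuple; $\lVert\cdot\rVert$ is the induced (Frobenius) norm; $\lambda_{\min}$ is the smallest eigenvalue of a symmetric matrix. The starred gradient $\nabla^{\star}\mathcal{J}(\mathbf{K})$ is the tuple with blocks $\nabla^{\star}_{K_i}\mathcal{J}(\mathbf{K})=2\sum_s\nu_s w_i(\rho_s)E_s\Sigma_s^\star$ (with $E_s$ evaluated at $\mathbf{K}$). With $\Delta_s=K_{\mathbf{K}}(\rho_s)-K_{\mathbf{K}^\star}(\rho_s)$, $Q_H(\mathbf{K})=\sum_s\nu_s\operatorname{tr}(\Sigma_s^\star\Delta_s^\top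 H_s\Delta_s)$, which is positive for $\mathbf{K}\neq\mathbf{K}^\star$. The remainder field is $\boldsymbol{\mathcal{R}}(\mathbf{K})=\tfrac12(\nabla^{\star}\mathcal{J}(\mathbf{K})-\nabla\mathcal{J}(\mathbf{K}))$, and for $\mathbf{K}\ne\mathbf{K}^\star$ the mismatch ratio is $\tau(\mathbf{K})=2\langle\boldsymbol{\mathcal{R}}(\mathbf{K}),\mathbf{K}-\mathbf{K}^\star\rangle/Q_H(\mathbf{K})$. For $c>\mathcal{J}^\star$, $\mathcal{G}_c$ is the connected component of $\{\mathbf{K}\in\mathcal{K}:\mathcal{J}(\mathbf{K})\le c\}$ containing $\mathbf{K}^\star$. *)

(* Defs.v *)
From HB Require Import structures.
From mathcomp Require Import all_boot all_order all_algebra.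
From mathcomp Require Import complex.
From mathcomp Require Import all_classical all_reals all_analysis.

Set Implicit Arguments.
Unset Strict Implicit.
Unset Printing Implicit Defensive.

Import Order.TTheory GRing.Theory Num.Theory.
Import numFieldNormedType.Exports.

Local Open Scope classical_set_scope.
Local Open Scope ring_scope.

Section Matrices.
Variables (R : realType) (n : nat).

Definition posdef (M : 'M[R]_n) : Prop :=
  M^T = M /\ forall x : 'cV[R]_n, x != 0 -> 0 < (x^T *m M *m x) 0 0.

(* Meant for symmetric M, whose spectrum is real. *)
Definition lambda_min (M : 'M[R]_n) : R := inf [set a | eigenvalue M a].

(* Largest modulus of a complex eigenvalue of the real matrix M. *)
Definition spectral_radius (M : 'M[R]_n) : R :=
  sup [set complex.Re `|z| | z in [set z : R[i] |
    eigenvalue (map_mx (real_complex R) M) z]].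

Definition schur_stable (M : 'M[R]_n) : Prop := spectral_radius M < 1.

End Matrices.

(* Raw data: vertex matrices, weighting functions on a space T of scheduling  *)
(* parameters, a grid of L points with its weights, cost matrices Q and Rc    *)
(* (state and input) and initial covariance Sigma0.                           *)
Record lpv (R : realType) (T : topologicalType) (N L n m : nat) := Lpv {
  vA : 'I_N -> 'M[R]_n ;
  vB : 'I_N -> 'M[R]_(n, m) ;
  wt : 'I_N -> T -> R ;
  rho : 'I_L -> T ;
  nu : 'I_L -> R ;
  costQ : 'M[R]_n ;
  costR : 'M[R]_m ;
  Sigma0 : 'M[R]_n
}.

(* The pointwise (product) topology is the Euclidean one, as N is finite. *)
Definition schedule (R : realType) (N n m : nat) :=
  {ptws 'I_N -> 'M[R]_(m, n)}.

Section Setting.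
Variables (R : realType) (T : topologicalType) (N L n m : nat).
Variable D : lpv R T N L n m.
Local Notation schedule := (schedule R N n m).
Implicit Types (s : 'I_L) (K : 'M[R]_(m, n)) (KK : schedule).

Definition plantA s : 'M[R]_n := \sum_i wt D i (rho D s) *: vA D i.
Definition plantB s : 'M[R]_(n, m) := \sum_i wt D i (rho D s) *: vB D i.

Definition closed_loop s K : 'M[R]_n := plantA s - plantB s *m K.

Definition stabilizes s K : Prop := schur_stable (closed_loop s K).

(* The solutions of the two Lyapunov equations below exist and are unique     *)
(* when K stabilizes plant s; otherwise the values are irrelevant.            *)
Definition value_mx s K : 'M[R]_n :=
  xget 0 [set P | P = (closed_loop s K)^T *m P *m closed_loop s K
                      + costQ D + K^T *m costR D *m K].

Definition covar_mx s K : 'M[R]_n :=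
  xget 0 [set X | X = closed_loop s K *m X *m (closed_loop s K)^T
                      + Sigma0 D].

Definition plant_cost s K : R := \tr (value_mx s K *m Sigma0 D).

Definition Hmx s K : 'M[R]_m :=
  costR D + (plantB s)^T *m value_mx s K *m plantB s.

Definition Emx s K : 'M[R]_(m, n) :=
  Hmx s K *m K - (plantB s)^T *m value_mx s K *m plantA s.

Definition deployed KK s : 'M[R]_(m, n) := \sum_i wt D i (rho D s) *: KK i.

Definition feasible : set schedule :=
  [set KK | forall s, stabilizes s (deployed KK s)].

Definition cost KK : R := \sum_s nu D s * plant_cost s (deployed KK s).

Definition is_minimizer KK : Prop :=
  feasible KK /\ forall KK', feasible KK' -> cost KK <= cost KK'.

Definition wvec s : 'cV[R]_N := \col_i wt D i (rho D s).
Definition Gw : 'M[R]_N := \sum_s nu D s *: (wvec s *m (wvec s)^T).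

Definition inner KK KK' : R := \sum_i \tr ((KK i)^T *m KK' i).

(* Gradient for [inner]: block i collects the partial derivatives of the cost *)
(* with respect to the entries of the i-th gain.  On the feasible set it is   *)
(* 2 \sum_s nu_s w_i(rho_s) E_s Sigma_s (compare [star_grad]).                *)
Definition grad KK : schedule := fun i => \matrix_(a, b)
  derive1 (fun h : R => cost (fun j =>
    if j == i then KK j + h *: delta_mx a b else KK j)) 0.

Variable KKstar : schedule.

Definition star_grad KK : schedule := fun i =>
  2 *: \sum_s (nu D s * wt D i (rho D s)) *:
    (Emx s (deployed KK s) *m covar_mx s (deployed KKstar s)).

Definition QH KK : R := \sum_s nu D s *
  \tr (covar_mx s (deployed KKstar s)
       *m (deployed KK s - deployed KKstar s)^T
       *m Hmx s (deployed KK s)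
       *m (deployed KK s - deployed KKstar s)).

Definition remainder KK : schedule := fun i =>
  2^-1 *: (star_grad KK i - grad KK i).

Definition tau KK : R :=
  2 * inner (remainder KK) (fun i => KK i - KKstar i) / QH KK.

Definition Gcomp (c : R) : set schedule :=
  connected_component [set KK | feasible KK /\ cost KK <= c] KKstar.

Definition gd_step (eta : R) KK : schedule := fun i => KK i - eta *: grad KK i.

Definition gd_iter (eta : R) (KK0 : schedule) (t : nat) : schedule :=
  iter t (gd_step eta) KK0.

End Setting.

(* Main.v *)
(* With Delta = K' - K and Sigma' the covariance at K', the cost of a plant    *)
(* satisfies exactly                                                          *)
(*   J(K') - J(K) = 2 tr(Delta^T E Sigma') + tr(Delta^T H Delta Sigma').      *)
(* For K' = K* this reads J(K) - Jmin = <grad* J(K), d> - Q_H(K), d = K - K*; *)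
(* the bound on tau turns the starred gradient into the gradient at the price *)
(* of tau0 Q_H, and Q_H >= mu / (4 (1 - tau0)) |d|^2, so that                 *)
(* J(K) - Jmin <= <grad J(K), d> - mu/4 |d|^2.  Completing squares gives both *)
(* |grad J|^2 >= mu (J - Jmin) and |d| <= (4 / mu) |grad J|.                  *)
(* For K' near K, Sigma(K) certifies the stability of the perturbed loop and  *)
(* Sigma' - Sigma = O(Delta), with constants depending only on a bound on the *)
(* cost.  Hence the same identity yields a second order expansion of the cost *)
(* that is uniform on {J <= c}: it identifies the gradient and shows that all *)
(* steps up to a uniform size decrease J by (eta / 2) |grad J|^2.  The        *)
(* segment between two iterates stays in {J <= c}, hence in the component.    *)

Require Import Defs.
From HB Require Import structures.
From mathcomp Require Import all_boot all_order all_algebra.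
From mathcomp Require Import complex.
From mathcomp Require Import all_classical all_reals all_analysis.
From mathcomp Require Import ring lra.

Import Order.TTheory GRing.Theory Num.Theory.
Import numFieldNormedType.Exports.

Set Implicit Arguments.
Unset Strict Implicit.
Unset Printing Implicit Defensive.

Local Open Scope classical_set_scope.
Local Open Scope ring_scope.

(** * Quadratic forms and semidefinite matrices *)

Section QuadraticForms.
Context {R : realType}.

(** One exact identity, [plant_cost_diff], carries both halves of the argument: the cost difference
    of two stabilizing gains is a linear plus a quadratic term in their difference, with the
    covariance taken at the second gain.

    With the minimizer as second gain it becomes [cost_gap], a global statement in which the starred
    gradient and [QH] appear. The bound on [tau] ([cost_gap_le]), the coercivity of [QH]
    ([QH_coercive]) and two completed squares ([inner_dominance]) then show that on the component
    the gradient dominates both the cost gap and the distance to the minimizer.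

    With a nearby second gain it becomes a local expansion ([plant_expansion], [cost_expansion]),
    since [lyapunov_perturb] controls how far the covariance moves. The explicit bounds of
    [plant_bounds] play the role of compactness of sublevel sets, so the constants depend only on a
    cost level. The expansion identifies the gradient ([gradE]) and gives one step bound for the
    whole sublevel set ([uniform_descent]); a step stays in the component because its whole segment
    stays in the sublevel set ([Gcomp_gd_step]). *)

Definition bil n (M : 'M[R]_n) (x y : 'cV[R]_n) : R := (x^T *m M *m y) 0 0.

Definition psd n (M : 'M[R]_n) : Prop := M^T = M /\ forall x, 0 <= bil M x x.

Context {n : nat}.
Implicit Types (M N : 'M[R]_n) (x y z : 'cV[R]_n) (a : R).

Lemma bilE M x y : bil M x y = \sum_i \sum_j x i 0 * M i j * y j 0.
Proof.
rewrite /bil mxE exchange_big /=; apply: eq_bigr => j _.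
by rewrite !mxE mulr_suml; apply: eq_bigr => i _; rewrite mxE.
Qed.

Lemma bilDl M x y z : bil M (x + y) z = bil M x z + bil M y z.
Proof. by rewrite /bil linearD /= !mulmxDl mxE. Qed.

Lemma bilDr M x y z : bil M z (x + y) = bil M z x + bil M z y.
Proof. by rewrite /bil !mulmxDr mxE. Qed.

Lemma bilZl M a x y : bil M (a *: x) y = a * bil M x y.
Proof. by rewrite /bil linearZ /= -!scalemxAl mxE. Qed.

Lemma bilZr M a x y : bil M x (a *: y) = a * bil M x y.
Proof. by rewrite /bil -!scalemxAr mxE. Qed.

Lemma bilD M N x y : bil (M + N) x y = bil M x y + bil N x y.
Proof. by rewrite /bil mulmxDr mulmxDl mxE. Qed.

Lemma bilN M x y : bil (- M) x y = - bil M x y.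
Proof. by rewrite /bil mulmxN mulNmx mxE. Qed.

Lemma bilB M N x y : bil (M - N) x y = bil M x y - bil N x y.
Proof. by rewrite bilD bilN. Qed.

Lemma bilZ a M x y : bil (a *: M) x y = a * bil M x y.
Proof. by rewrite /bil -scalemxAr -scalemxAl mxE. Qed.

Lemma bilC M x y : M^T = M -> bil M x y = bil M y x.
Proof.
move=> sM; rewrite /bil -[RHS]/(fun_of_matrix _ 0 0).
rewrite -[in LHS](trmxK (x^T *m M *m y)) mxE !trmx_mul trmxK sM.
by rewrite mulmxA.
Qed.

Lemma bil_delta M i j : bil M (delta_mx i 0) (delta_mx j 0) = M i j.
Proof. by rewrite /bil trmx_delta -rowE -colE !mxE. Qed.

Lemma bil_congr p (A : 'M[R]_(n, p)) (M : 'M[R]_p) x y :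
  bil (A *m M *m A^T) x y = bil M (A^T *m x) (A^T *m y).
Proof. by rewrite /bil trmx_mul trmxK !mulmxA. Qed.

Lemma bil1 a x y : bil a%:M x y = a * \sum_i x i 0 * y i 0.
Proof.
rewrite /bil mul_mx_scalar -scalemxAl mxE mxE; congr (_ * _).
by apply: eq_bigr => i _; rewrite mxE.
Qed.

Lemma bil_outer (u : 'cV[R]_n) x y :
  bil (u *m u^T) x y = (x^T *m u) 0 0 * (u^T *m y) 0 0.
Proof. by rewrite /bil mulmxA -mulmxA mxE big_ord1. Qed.

Lemma bil_sum (I : finType) (F : I -> 'M[R]_n) x y :
  bil (\sum_i F i) x y = \sum_i bil (F i) x y.
Proof.
apply: (big_morph (fun M => bil M x y)) => [M M'|]; first exact: bilD.
by rewrite /bil mulmx0 mul0mx mxE.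
Qed.

Lemma psd0 : psd (0 : 'M[R]_n).
Proof. by split=> [|x]; rewrite ?trmx0 // /bil mulmx0 mul0mx mxE. Qed.

Lemma psdD M N : psd M -> psd N -> psd (M + N).
Proof.
move=> [sM pM] [sN pN]; split=> [|x]; first by rewrite linearD /= sM sN.
by rewrite bilD addr_ge0.
Qed.

Lemma psdZ a M : 0 <= a -> psd M -> psd (a *: M).
Proof.
move=> a0 [sM pM]; split=> [|x]; first by rewrite linearZ /= sM.
by rewrite bilZ mulr_ge0.
Qed.

Lemma psd_congr p (A : 'M[R]_(n, p)) (M : 'M[R]_p) :
  psd M -> psd (A *m M *m A^T).
Proof.
move=> [sM pM]; split=> [|x]; first by rewrite !trmx_mul trmxK sM mulmxA.
by rewrite bil_congr.
Qed.

Lemma psd_scalar a : 0 <= a -> psd (a%:M : 'M[R]_n).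
Proof.
move=> a0; split=> [|x]; first by rewrite tr_scalar_mx.
by rewrite bil1 mulr_ge0 // sumr_ge0 // => i _; rewrite -expr2 sqr_ge0.
Qed.

Lemma posdef_psd M : posdef M -> psd M.
Proof.
move=> [sM pM]; split=> // x; have [->|/pM/ltW //] := eqVneq x 0.
by rewrite /bil mulmx0 mxE.
Qed.

Lemma psd_diag_ge0 M i : psd M -> 0 <= M i i.
Proof. by move=> [_ pM]; rewrite -bil_delta. Qed.

Lemma psd_CS M x y : psd M -> bil M x y ^+ 2 <= bil M x x * bil M y y.
Proof.
move=> [sM pM]; set a := bil M x x; set b := bil M x y; set c := bil M y y.
have q s t : 0 <= s ^+ 2 * a + 2 * s * t * b + t ^+ 2 * c.
  have := pM (s *: x + t *: y).
  rewrite !(bilDl, bilDr, bilZl, bilZr) (bilC y x sM) -/a -/b -/c.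
  by congr (0 <= _); ring.
have c0 : 0 <= c := pM y.
have [c_gt0|] := ltP 0 c.
  (* The minimizing direction turns the quadratic form into c (a c - b^2). *)
  have := q c (- b).
  have -> : c ^+ 2 * a + 2 * c * - b * b + (- b) ^+ 2 * c = c * (a * c - b ^+ 2).
    by ring.
  by rewrite pmulr_rge0 // subr_ge0.
move=> c_le0; have c00 : c = 0 by apply/eqP; rewrite eq_le c0 c_le0.
rewrite c00 mulr0; have [->|b0] := eqVneq b 0; first by rewrite expr0n.
(* With c = 0 the form is affine in t for s = 1, and this t would give it the value -1. *)
have := q 1 (- (a + 1) / (2 * b)); rewrite c00.
have -> : 1 ^+ 2 * a + 2 * 1 * (- (a + 1) / (2 * b)) * b
          + (- (a + 1) / (2 * b)) ^+ 2 * 0 = -1 by field.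
by rewrite oppr_ge0 ler10.
Qed.

Lemma psd_entry M i j : psd M -> `|M i j| <= M i i + M j j.
Proof.
move=> pM; have := psd_CS (delta_mx i 0) (delta_mx j 0) pM; rewrite !bil_delta.
have := psd_diag_ge0 i pM; have := psd_diag_ge0 j pM.
move: (M i j) (M i i) (M j j) => b c a a0 c0 h.
by rewrite ler_norml; apply/andP; split; nra.
Qed.

(** Cauchy-Schwarz between the i-th basis vector and x bounds (e_i^T M x)^2 by M_ii (x^T M x); the
    difference is a Schur complement. *)
Lemma psd_sub_outer M i : psd M -> 0 < M i i ->
  psd (M - (M i i)^-1 *: (col i M *m (col i M)^T)).
Proof.
move=> pM mi; have [sM _] := pM; split=> [|x].
  by rewrite linearB linearZ /= trmx_mul trmxK sM.
have e : ((col i M)^T *m x) 0 0 = bil M (delta_mx i 0) x.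
  by rewrite /bil trmx_delta colE trmx_mul trmx_delta sM.
have e' : (x^T *m col i M) 0 0 = bil M (delta_mx i 0) x.
  by rewrite bilC // /bil colE mulmxA.
rewrite bilB bilZ bil_outer e e' subr_ge0 mulrC ler_pdivrMr // -expr2 mulrC.
by rewrite -{1}(bil_delta M i i) psd_CS.
Qed.

(* Deflation: removing the rank one part of M supported by a nonzero diagonal *)
(* entry keeps M semidefinite and kills that diagonal entry.                  *)
Lemma psd_trace_mul M N : psd M -> psd N -> 0 <= \tr (M *m N).
Proof.
move=> + pN; have [k] := ubnP #|[set i | M i i != 0]|%SET.
elim: k M => // k IH M ltk pM.
have [M0|[i Mi]] : (forall i, M i i = 0) \/ exists i, M i i != 0.
  have [/forallP h|/forallPn [i Mi]] := boolP [forall i, M i i == 0].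
    by left=> i; apply/eqP.
  by right; exists i.
  have -> : M = 0.
    apply/matrixP => i j; have := psd_entry i j pM.
    by rewrite !M0 addr0 normr_le0 mxE => /eqP.
  by rewrite mul0mx mxtrace0.
have mi : 0 < M i i by rewrite lt_def Mi psd_diag_ge0.
have pM' := psd_sub_outer pM mi.
set M' := M - _ in pM'.
have M'ii : M' i i = 0.
  by rewrite !mxE big_ord1 !mxE mulKf ?subrr.
have trE : \tr (M *m N) = \tr (M' *m N) + (M i i)^-1 * bil N (col i M) (col i M).
  rewrite /M' mulmxBl linearB /= -scalemxAl linearZ /= -mulmxA.
  by rewrite [\tr (col i M *m _)]mxtrace_mulC trace_mx11 subrK.
rewrite trE addr_ge0 //; last first.
  by rewrite mulr_ge0 ?invr_ge0 ?(ltW mi) //; case: pN.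
apply: IH => //; rewrite -ltnS (leq_trans _ ltk) // ltnS proper_card //.
apply/properP; split; last by exists i; rewrite inE ?Mi ?M'ii ?eqxx.
apply/fintype.subsetP => j; rewrite !inE; apply: contraNN => /eqP Mj.
rewrite eq_le (psd_diag_ge0 j pM') andbT !mxE Mj add0r oppr_le0.
rewrite mulr_ge0 ?invr_ge0 ?(ltW mi) // big_ord1 !mxE.
by rewrite -expr2 sqr_ge0.
Qed.

(** This is how lower bounds on Q, Sigma0 and the covariance turn a bound on the cost into bounds on
    traces. *)
Lemma trace_mul_ge M N a :
  psd M -> psd (N - a%:M) -> a * \tr M <= \tr (M *m N).
Proof.
move=> pM pN; have := psd_trace_mul pM pN.
by rewrite mulmxBr linearB /= mul_mx_scalar linearZ subr_ge0.
Qed.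

End QuadraticForms.

(** * Entrywise and Frobenius norms *)

Section EntrywiseNorm.
Context {R : realType}.

(** The estimates need only some norm that is submultiplicative, invariant under transposition and
    an upper bound for the trace; the size of the constants is irrelevant. *)
Definition l1 m n (A : 'M[R]_(m, n)) : R := \sum_i \sum_j `|A i j|.

Lemma l1_ge0 m n (A : 'M[R]_(m, n)) : 0 <= l1 A.
Proof. by apply: sumr_ge0 => i _; apply: sumr_ge0. Qed.

Lemma l1_entry m n (A : 'M[R]_(m, n)) i j : `|A i j| <= l1 A.
Proof.
rewrite /l1 (bigD1 i) //= (bigD1 j) //= -addrA lerDl addr_ge0 ?sumr_ge0 //.
by move=> k _; rewrite sumr_ge0.
Qed.

Lemma l1D m n (A B : 'M[R]_(m, n)) : l1 (A + B) <= l1 A + l1 B.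
Proof.
rewrite /l1 -big_split; apply: ler_sum => i _; rewrite -big_split /=.
by apply: ler_sum => j _; rewrite mxE ler_normD.
Qed.

Lemma l1N m n (A : 'M[R]_(m, n)) : l1 (- A) = l1 A.
Proof.
by apply: eq_bigr => i _; apply: eq_bigr => j _; rewrite mxE normrN.
Qed.

Lemma l1B m n (A B : 'M[R]_(m, n)) : l1 (A - B) <= l1 A + l1 B.
Proof. by rewrite (le_trans (l1D _ _)) // l1N. Qed.

Lemma l1Z m n a (A : 'M[R]_(m, n)) : l1 (a *: A) = `|a| * l1 A.
Proof.
rewrite /l1 mulr_sumr; apply: eq_bigr => i _; rewrite mulr_sumr.
by apply: eq_bigr => j _; rewrite mxE normrM.
Qed.

Lemma l1_tr m n (A : 'M[R]_(m, n)) : l1 A^T = l1 A.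
Proof.
rewrite /l1 exchange_big; apply: eq_bigr => i _.
by apply: eq_bigr => j _; rewrite mxE.
Qed.

Lemma l1_sum (I : Type) (r : seq I) m n (F : I -> 'M[R]_(m, n)) :
  l1 (\sum_(i <- r) F i) <= \sum_(i <- r) l1 (F i).
Proof.
elim/big_ind2: _ => // [|A a B b hA hB].
  by rewrite /l1 big1 // => i _; rewrite big1 // => j _; rewrite mxE normr0.
by rewrite (le_trans (l1D _ _)) // lerD.
Qed.

Lemma l1M m n p (A : 'M[R]_(m, n)) (B : 'M[R]_(n, p)) :
  l1 (A *m B) <= l1 A * l1 B.
Proof.
rewrite {2}/l1 mulr_suml; apply: ler_sum => i _.
have le1 : \sum_j `|(A *m B) i j| <= \sum_j \sum_k `|A i k| * `|B k j|.
  apply: ler_sum => j _; rewrite mxE (le_trans (ler_norm_sum _ _ _)) //.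
  by apply: ler_sum => k _; rewrite normrM.
apply: (le_trans le1); rewrite exchange_big mulr_suml; apply: ler_sum => k _.
rewrite -mulr_sumr ler_wpM2l // /l1 (bigD1 k) //= lerDl.
by rewrite sumr_ge0 // => l _; rewrite sumr_ge0.
Qed.

Lemma l1_trace n (A : 'M[R]_n) : `|\tr A| <= l1 A.
Proof.
rewrite (le_trans (ler_norm_sum _ _ _)) //; apply: ler_sum => i _.
by rewrite (bigD1 i) //= lerDl sumr_ge0.
Qed.

Lemma l1M_le p q r (Y : 'M[R]_(p, q)) (Z : 'M[R]_(q, r)) (a b : R) :
  l1 Y <= a -> l1 Z <= b -> l1 (Y *m Z) <= a * b.
Proof. by move=> ha hb; rewrite (le_trans (l1M _ _)) // ler_pM ?l1_ge0. Qed.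

Lemma fro_sum m n (A B : 'M[R]_(m, n)) :
  \tr (A^T *m B) = \sum_i \sum_j A i j * B i j.
Proof.
rewrite exchange_big; apply: eq_bigr => j _; rewrite mxE.
by apply: eq_bigr => i _; rewrite mxE.
Qed.

Lemma fro_ge0 m n (A : 'M[R]_(m, n)) : 0 <= \tr (A^T *m A).
Proof.
rewrite fro_sum sumr_ge0 // => i _; rewrite sumr_ge0 // => j _.
by rewrite -expr2 sqr_ge0.
Qed.

Lemma fro_le_l1 p q (Y : 'M[R]_(p, q)) : \tr (Y^T *m Y) <= l1 Y ^+ 2.
Proof.
by rewrite (le_trans (ler_norm _)) // (le_trans (l1_trace _)) // expr2 l1M_le ?l1_tr.
Qed.

Lemma fro_entry m n (A : 'M[R]_(m, n)) i j : A i j ^+ 2 <= \tr (A^T *m A).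
Proof.
rewrite fro_sum (bigD1 i) //= (bigD1 j) //= -addrA -expr2 lerDl.
rewrite addr_ge0 ?sumr_ge0 // => [k _|k _]; rewrite -?expr2 ?sqr_ge0 //.
by rewrite sumr_ge0 // => l _; rewrite -expr2 sqr_ge0.
Qed.

Lemma fro_eq0 m n (A : 'M[R]_(m, n)) : \tr (A^T *m A) <= 0 -> A = 0.
Proof.
move=> h; apply/matrixP => i j; rewrite mxE; apply/eqP; rewrite -sqrf_eq0.
by rewrite eq_le sqr_ge0 (le_trans (fro_entry A i j)).
Qed.

Lemma l1_le_fro m n (A : 'M[R]_(m, n)) (a : R) :
  0 <= a -> \tr (A^T *m A) <= a ^+ 2 -> l1 A <= (m * n)%:R * a.
Proof.
move=> a0 h; have le_a i j : `|A i j| <= a.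
  by rewrite -ler_sqr ?nnegrE // real_normK ?num_real // (le_trans (fro_entry A i j)).
have : l1 A <= \sum_(i < m) \sum_(j < n) a.
  by apply: ler_sum => i _; apply: ler_sum => j _.
by rewrite sumr_const sumr_const !card_ord -mulrnA mulr_natl mulnC.
Qed.

Context {n : nat}.
Implicit Types (M D : 'M[R]_n) (x y : 'cV[R]_n).

Lemma bil1_ge0 x : 0 <= bil 1%:M x x.
Proof. by case: (psd_scalar (n := n) (ler01 : 0 <= 1 :> R)). Qed.

Lemma bil1_gt0 x : x != 0 -> 0 < bil 1%:M x x.
Proof.
move=> x0; rewrite lt_def bil1_ge0 andbT; apply: contra x0 => /eqP.
rewrite /bil mulmx1 -trace_mx11 => h.
by apply/eqP; apply: fro_eq0; rewrite h.
Qed.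

Lemma bil_scalar (a : R) x y : bil a%:M x y = a * bil 1%:M x y.
Proof. by rewrite -[a%:M]scalemx1 bilZ. Qed.

Lemma bil_le_l1 M x : bil M x x <= l1 M * bil 1%:M x x.
Proof.
rewrite bil1 mul1r bilE mulr_suml; apply: ler_sum => i _.
rewrite mulr_suml; apply: ler_sum => j _.
rewrite (le_trans (ler_norm _)) // !normrM mulrAC mulrC ler_wpM2l //.
set S := \sum_k _; have hS k : x k 0 ^+ 2 <= S.
  rewrite /S (bigD1 k) //= -expr2 lerDl sumr_ge0 // => l _.
  by rewrite -expr2 sqr_ge0.
have := hS i; have := hS j; rewrite -[x i 0 ^+ 2]real_normK ?num_real //.
rewrite -[x j 0 ^+ 2]real_normK ?num_real //; nra.
Qed.

Lemma psd_l1_sub M : M^T = M -> psd ((l1 M)%:M - M).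
Proof.
move=> sM; split=> [|x]; first by rewrite linearB /= tr_scalar_mx sM.
by rewrite bilB bil_scalar subr_ge0 bil_le_l1.
Qed.

(** Apply [psd_entry] to M + D and M - D and add: the diagonal of D cancels, leaving |D_ij| <= M_ii
    + M_jj. *)
Lemma psd_sandwich_l1 M D :
  psd (M + D) -> psd (M - D) -> l1 D <= 2 * n%:R * \tr M.
Proof.
move=> pP pN.
have : l1 D <= \sum_i \sum_j (M i i + M j j).
  apply: ler_sum => i _; apply: ler_sum => j _.
  have := psd_entry i j pP; have := psd_entry i j pN; rewrite !mxE.
  rewrite !ler_norml => /andP[a1 a2] /andP[b1 b2]; apply/andP; split; lra.
move/le_trans; apply; rewrite le_eqVlt; apply/orP; left; apply/eqP.
under eq_bigr do rewrite big_split /= sumr_const card_ord.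
rewrite big_split /= sumr_const card_ord sumrMnl -mulr2n -mulrnA -[LHS]mulr_natl.
by rewrite natrM /mxtrace; ring.
Qed.

Lemma psd_l1 M : psd M -> l1 M <= 2 * n%:R * \tr M.
Proof.
move=> pM; apply: psd_sandwich_l1; last by rewrite subrr; apply: psd0.
exact: psdD.
Qed.

Lemma psd_trace_ge0 M : psd M -> 0 <= \tr M.
Proof. by move=> pM; apply: sumr_ge0 => i _; apply: psd_diag_ge0. Qed.

End EntrywiseNorm.

(** * The smallest eigenvalue of a symmetric matrix *)

Section SmallestEigenvalue.
Context {R : realType} {n : nat}.
Implicit Types (M : 'M[R]_n) (x y : 'cV[R]_n).

(* Cauchy-Schwarz between x and M^-1 x gives |x|^4 <= (x^T M x) (x^T M^-1 x), *)
(* so x^T M x >= |x|^2 / |M^-1|.                                              *)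
Lemma psd_margin M : psd M -> (forall x, M *m x = 0 -> x = 0) ->
  exists2 e : R, 0 < e & psd (M - e%:M).
Proof.
move=> pM inj; have [sM _] := pM.
have uM : M \in unitmx.
  rewrite -row_free_unit; apply: inj_row_free => v vM.
  by apply: trmx_inj; rewrite trmx0; apply: inj; rewrite -[M]sM -trmx_mul vM trmx0.
have k0 : 0 < l1 (invmx M) + 1 by rewrite ltr_wpDl ?l1_ge0.
exists (l1 (invmx M) + 1)^-1; rewrite ?invr_gt0 //; split=> [|x].
  by rewrite linearB /= tr_scalar_mx sM.
rewrite bilB bil_scalar subr_ge0 mulrC ler_pdivrMr //.
have Mz : M *m (invmx M *m x) = x by rewrite mulKVmx.
have := psd_CS x (invmx M *m x) pM.
have -> : bil M x (invmx M *m x) = bil 1%:M x x.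
  by rewrite /bil -mulmxA Mz mulmx1.
have -> : bil M (invmx M *m x) (invmx M *m x) = bil (invmx M) x x.
  by rewrite /bil -[_ *m (_ *m x)]mulmxA Mz trmx_mul trmx_inv sM.
have := bil_le_l1 (invmx M) x; have := bil1_ge0 x.
case: pM => _ /(_ x); have := l1_ge0 (invmx M).
move: (bil M x x) (bil (invmx M) x x) (bil 1%:M x x) (l1 _) => a b c k.
move=> k_ge0 a0 c0 bk h; have [->|c_neq0] := eqVneq c 0.
  by rewrite mulr_ge0 ?addr_ge0.
have c_gt0 : 0 < c by rewrite lt_def c_neq0.
have : c ^+ 2 <= a * (k * c) by rewrite (le_trans h) // ler_wpM2l.
by rewrite expr2 mulrA ler_pM2r // => /le_trans; apply; nra.
Qed.

(** The largest t with M - t I semidefinite is an eigenvalue, for otherwise [psd_margin] would allow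
    a larger t, and it lies below every eigenvalue. Positive dimension keeps the spectrum
    nonempty. *)
Lemma lambda_min_spec M : (0 < n)%N -> M^T = M ->
  psd (M - (lambda_min M)%:M) /\ eigenvalue M (lambda_min M).
Proof.
move=> n0 sM; pose S := [set t : R | psd (M - t%:M)].
have S_ub i : ubound S (M i i).
  by move=> t /= /(psd_diag_ge0 i); rewrite !mxE eqxx mulr1n subr_ge0.
have S0 : S (- l1 M).
  have := psd_l1_sub (M := - M); rewrite linearN /= sM => /(_ erefl).
  by rewrite l1N opprK addrC /S /= raddfN /= opprK.
have supS : has_sup S by split; [exists (- l1 M) | exists (M (Ordinal n0) (Ordinal n0))].
pose t0 := sup S.
have pt0 : psd (M - t0%:M).
  split=> [|x]; first by rewrite linearB /= tr_scalar_mx sM.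
  have [->|x0] := eqVneq x 0; first by rewrite /bil mulmx0 mxE.
  rewrite bilB bil_scalar subr_ge0 -ler_pdivlMr ?bil1_gt0 //.
  apply: ge_sup; first by exists (- l1 M).
  move=> t [_ /(_ x)]; rewrite bilB bil_scalar subr_ge0.
  by rewrite -ler_pdivlMr ?bil1_gt0.
have [x x0 Mx] : exists2 x : 'cV[R]_n, x != 0 & M *m x = t0 *: x.
  apply: contrapT => h; have [|e e0 pe] := psd_margin pt0.
    move=> x.
    rewrite mulmxBl mul_scalar_mx => /eqP; rewrite subr_eq0 => /eqP hx.
    by apply/eqP; apply: contra_notT h => x0; exists x.
  have : S (t0 + e) by rewrite /S /= raddfD /= opprD addrA.
  by move/(ub_le_sup (proj2 supS)); rewrite gerDl leNgt e0.
have ev : eigenvalue M t0.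
  apply/eigenvalueP; exists x^T; last by rewrite -trmx0 (inj_eq trmx_inj).
  by rewrite -{1}sM -trmx_mul Mx linearZ.
have low a : eigenvalue M a -> t0 <= a.
  move=> /eigenvalueP[v vM v0].
  have vt0 : v^T != 0 by rewrite -trmx0 (inj_eq trmx_inj).
  have [_ /(_ v^T)] := pt0; rewrite bilB bil_scalar.
  have -> : bil M v^T v^T = a * bil 1%:M v^T v^T.
    by rewrite /bil !trmxK vM mulmx1 -scalemxAl mxE.
  by rewrite -mulrBl pmulr_lge0 ?bil1_gt0 // subr_ge0.
suff -> : lambda_min M = t0 by [].
apply/le_anti/andP; split; first by apply: ge_inf => //; exists t0 => a /low.
by apply: lb_le_inf => [|a /low //]; exists t0.
Qed.

Lemma lambda_min_gt0 M : (0 < n)%N -> posdef M -> 0 < lambda_min M.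
Proof.
move=> n0 [sM pM]; have [_ /eigenvalueP[v vM v0]] := lambda_min_spec n0 sM.
have vt0 : v^T != 0 by rewrite -trmx0 (inj_eq trmx_inj).
have := pM _ vt0; rewrite trmxK vM -scalemxAl mxE.
have -> : (v *m v^T) 0 0 = bil 1%:M v^T v^T by rewrite /bil trmxK mulmx1.
by rewrite pmulr_lgt0 ?bil1_gt0.
Qed.

Lemma posdef_margin M : posdef M -> exists2 e : R, 0 < e & psd (M - e%:M).
Proof.
move=> pM; have [sM _] := pM; have [n0|] := posnP n; last first.
  move=> n0; exists (lambda_min M); first exact: lambda_min_gt0.
  by have [] := lambda_min_spec n0 sM.
exists 1 => //; split=> [|x]; first by rewrite linearB /= tr_scalar_mx sM.
by rewrite bilE big1 // => i; have := ltn_ord i; rewrite [X in (_ < X)%N]n0.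
Qed.

End SmallestEigenvalue.

(** * Schur stability and powers of a matrix *)

Section SchurStable.
Context {R : realType}.
Local Notation normc := ComplexField.Normc.normc.

Lemma normc_ge0 (z : R[i]) : 0 <= normc z.
Proof. by case: z => a b; rewrite /normc sqrtr_ge0. Qed.

Lemma Re_normE (z : R[i]) : complex.Re `|z| = normc z.
Proof. by case: z. Qed.

Lemma normc_real (x : R) : normc (real_complex R x) = `|x|.
Proof. by rewrite /= expr0n addr0 sqrtr_sqr. Qed.

Lemma normc_sum (I : Type) (r : seq I) (P : pred I) (F : I -> R[i]) :
  normc (\sum_(i <- r | P i) F i) <= \sum_(i <- r | P i) normc (F i).
Proof.
elim/big_ind2: _ => [|x a y b hx hy|//].
  by rewrite ComplexField.Normc.normc0.
by rewrite (le_trans (@le_normcD R a b)) // lerD.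
Qed.

(* Weights M^j with M large make the off-diagonal part of a triangular matrix *)
(* negligible, so that its weighted row sums are governed by the diagonal.    *)
Lemma trig_weights n (T : 'M[R[i]]_n) :
  is_trig_mx T -> (forall i, normc (T i i) < 1) ->
  exists q (d : 'I_n -> R), [/\ 0 <= q < 1, forall i, 1 <= d i &
    forall i, \sum_j normc (T i j) * d j <= q * d i].
Proof.
move=> /is_trig_mxP trT ltT1.
pose r := \big[Order.max/0]_i normc (T i i).
have r1 : r < 1 by apply: bigmax_lt.
have r0 : 0 <= r by apply: bigmax_ge_id.
pose a := \sum_i \sum_j normc (T i j).
have a0 : 0 <= a by do 2![apply: sumr_ge0 => ? _]; apply: normc_ge0.
(* Large enough that the off-diagonal part, which carries a factor 1 / M, uses at most half of the
   gap 1 - r. *)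
pose M := 1 + 2 * a / (1 - r).
have M1 : 1 <= M by rewrite lerDl divr_ge0 ?mulr_ge0 // subr_ge0 ltW.
have M0 : 0 < M by rewrite (lt_le_trans ltr01).
have aM : a / M <= (1 - r) / 2.
  rewrite ler_pdivrMr //.
  have -> : (1 - r) / 2 * M = (1 - r) / 2 + a.
    by rewrite /M; field; rewrite subr_eq0 gt_eqF.
  by rewrite lerDr divr_ge0 // subr_ge0 ltW.
exists ((1 + r) / 2), (fun i => M ^+ i); split=> [|i|i].
- by apply/andP; split; lra.
- exact: exprn_ege1.
have -> : (1 + r) / 2 = r + (1 - r) / 2 by field.
rewrite (bigD1 i) //= mulrDl lerD //.
  by rewrite ler_wpM2r ?exprn_ge0 ?(ltW M0) // /r; exact: le_bigmax.
apply: (@le_trans _ _ (\sum_(j | j != i) normc (T i j) * (M ^+ i / M))).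
  apply: ler_sum => j ji; have [ltij|leji] := ltnP i j.
    by rewrite trT // ComplexField.Normc.normc0 !mul0r.
  have ltji : (j < i)%N by rewrite ltn_neqAle ji.
  rewrite ler_wpM2l ?normc_ge0 // ler_pdivlMr // -exprSr.
  exact: ler_weXn2l.
rewrite -mulr_suml [leLHS]mulrA [leLHS]mulrAC ler_wpM2r ?exprn_ge0 ?(ltW M0) //.
apply: le_trans aM; rewrite ler_wpM2r ?invr_ge0 ?(ltW M0) //.
rewrite /a [leRHS](bigD1 i) //= [\sum_j normc (T i j)](bigD1 i) //=.
rewrite -addrA addrCA lerDl addr_ge0 ?normc_ge0 //.
by do 2![apply: sumr_ge0 => ? _]; apply: normc_ge0.
Qed.

(** The weighted row sums form an operator norm, so the bound q passes to q^k for the k-th power;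
    removing the weights costs a constant factor because they are at least 1. *)
Lemma trig_pow_bound n (T : 'M[R[i]]_n) :
  is_trig_mx T -> (forall i, normc (T i i) < 1) ->
  exists q C, [/\ 0 <= q, q < 1 & forall k i j, normc ((T ^+ k) i j) <= C * q ^+ k].
Proof.
move=> trT ltT1; have [q [d [/andP[q0 q1] d1 rowq]]] := trig_weights trT ltT1.
have d0 i : 0 <= d i by rewrite (le_trans ler01).
have pw k i : \sum_j normc ((T ^+ k) i j) * d j <= q ^+ k * d i.
  elim: k i => [|k IH] i.
    rewrite !expr0 mul1r (bigD1 i) //= big1 => [|j ji]; rewrite mxE.
      by rewrite eqxx ComplexField.Normc.normc1 mul1r addr0.
    by rewrite eq_sym (negbTE ji) ComplexField.Normc.normc0 mul0r.
  apply: (@le_trans _ _ (\sum_j \sum_l normc (T i l) * normc ((T ^+ k) l j) * d j)).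
    apply: ler_sum => j _; rewrite -mulr_suml ler_wpM2r //.
    rewrite exprS mxE (le_trans (normc_sum _ _ _)) //.
    by apply: ler_sum => l _; rewrite ComplexField.Normc.normcM.
  rewrite exchange_big /=.
  apply: (@le_trans _ _ (\sum_l normc (T i l) * (q ^+ k * d l))).
    apply: ler_sum => l _; under eq_bigr do rewrite -mulrA.
    by rewrite -mulr_sumr ler_wpM2l ?normc_ge0.
  rewrite exprSr -mulrA.
  under eq_bigr do rewrite mulrCA.
  by rewrite -mulr_sumr ler_wpM2l ?exprn_ge0.
exists q, (\sum_i d i); split=> // k i j.
have le1 : normc ((T ^+ k) i j) <= \sum_j normc ((T ^+ k) i j) * d j.
  rewrite (bigD1 j) //= -[leLHS]addr0 lerD ?ler_peMr ?normc_ge0 //.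
  by apply: sumr_ge0 => l _; rewrite mulr_ge0 ?normc_ge0.
rewrite (le_trans le1) // (le_trans (pw k i)) // mulrC ler_wpM2r ?exprn_ge0 //.
by rewrite (bigD1 i) //= lerDl sumr_ge0.
Qed.

(** Schur triangularization puts the eigenvalues on the diagonal; the change of basis only affects
    the constant. *)
Lemma complex_pow_bound n (B : 'M[R[i]]_n) :
  (forall z, eigenvalue B z -> normc z < 1) ->
  exists q C, [/\ 0 <= q, q < 1 & forall k i j, normc ((B ^+ k) i j) <= C * q ^+ k].
Proof.
case: n B => [|n] B evB.
  by exists 0, 0; split=> // k [].
have [P Pun trT] := Schur B (ltn0Sn n).
have Pu := unitarymx_unit Pun.
have {}trT : is_trig_mx (P *m B *m invmx P) by rewrite -conjumx.
set T := P *m B *m invmx P in trT.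
have TP : T *m P = P *m B by rewrite /T mulmxKV.
have evT i : normc (T i i) < 1.
  have /eigenvalueP[v vT v0] : eigenvalue T (T i i).
    rewrite eigenvalue_root_char char_poly_trig // rootE horner_prod.
    by rewrite (bigD1 i) //= hornerXsubC subrr mul0r.
  apply/evB/eigenvalueP; exists (v *m P); first by rewrite -mulmxA -TP mulmxA vT scalemxAl.
  by apply: contra v0 => /eqP h; rewrite -(mulmxK Pu v) h mul0mx.
have [q [C [q0 q1 bT]]] := trig_pow_bound trT evT.
have powB k : B ^+ k = invmx P *m T ^+ k *m P.
  elim: k => [|k IH]; first by rewrite !expr0 mulmx1 mulVmx.
  by rewrite !exprSr IH -[_ * B]/(_ *m B) -[_ * T]/(_ *m T) -(mulmxA _ P B) -TP !mulmxA.
have normM m1 m2 m3 (X : 'M[R[i]]_(m1, m2)) (Y : 'M[R[i]]_(m2, m3)) i j :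
    normc ((X *m Y) i j) <= \sum_l normc (X i l) * normc (Y l j).
  rewrite mxE (le_trans (normc_sum _ _ _)) //; apply: ler_sum => l _.
  by rewrite ComplexField.Normc.normcM.
exists q, (\sum_i \sum_j \sum_l \sum_p normc (invmx P i p) * C * normc (P l j)).
split=> // k i j; rewrite powB (le_trans (normM _ _ _ _ _ _ _)) //.
have C0 : 0 <= C.
  by have := bT 0 ord0 ord0; rewrite expr0 mulr1; apply: le_trans; apply: normc_ge0.
have h0 i' j' : 0 <= \sum_l \sum_p normc (invmx P i' p) * C * normc (P l j').
  by do 2![apply: sumr_ge0 => ? _]; rewrite !mulr_ge0 ?normc_ge0.
apply: (@le_trans _ _ ((\sum_l \sum_p normc (invmx P i p) * C * normc (P l j)) * q ^+ k)).
  rewrite mulr_suml; apply: ler_sum => l _; rewrite mulr_suml.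
  apply: (@le_trans _ _ (\sum_p normc (invmx P i p) * (C * q ^+ k) * normc (P l j))).
    rewrite -mulr_suml ler_wpM2r ?normc_ge0 // (le_trans (normM _ _ _ _ _ _ _)) //.
    by apply: ler_sum => p _; rewrite ler_wpM2l ?normc_ge0.
  by apply: ler_sum => p _; rewrite le_eqVlt; apply/orP; left; apply/eqP; ring.
rewrite ler_wpM2r ?exprn_ge0 // [leRHS](bigD1 i) //= [X in _ <= X + _](bigD1 j) //= -[leRHS]addrA lerDl.
apply: addr_ge0; apply: sumr_ge0 => i' _; first exact: h0.
by apply: sumr_ge0 => j' _; apply: h0.
Qed.

Lemma eigenvalue_trmx (F : fieldType) n (A : 'M[F]_n) a :
  eigenvalue A^T a = eigenvalue A a.
Proof.
rewrite !eigenvalue_root_char /char_poly -[in RHS]det_tr.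
by rewrite /char_poly_mx linearB /= tr_scalar_mx map_trmx.
Qed.

(** Makes the [sup] in [spectral_radius] a genuine upper bound. The eigenvalues are among the
    finitely many roots of the characteristic polynomial. *)
Lemma eigenvalues_bounded n (B : 'M[R[i]]_n) :
  exists C, forall z, eigenvalue B z -> normc z <= C.
Proof.
have [r charE] := closed_field_poly_normal (char_poly B).
exists (\sum_(z <- r) normc z) => z.
rewrite eigenvalue_root_char charE (monicP (char_poly_monic B)) scale1r.
rewrite root_prod_XsubC => zr; rewrite (big_rem z) //= lerDl.
by apply: sumr_ge0 => ? _; apply: normc_ge0.
Qed.

Lemma normc_le_spectral_radius n (A : 'M[R]_n) z :
  eigenvalue (map_mx (real_complex R) A) z -> normc z <= spectral_radius A.
Proof.
move=> ez; rewrite -Re_normE; apply: ub_le_sup; last by exists z.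
have [C hC] := eigenvalues_bounded (map_mx (real_complex R) A).
by exists C => _ [w ew <-]; rewrite Re_normE; apply: hC.
Qed.

Lemma normc_schur_stable n (A : 'M[R]_n) (q : R) : q < 1 ->
  (forall z, eigenvalue (map_mx (real_complex R) A) z -> normc z <= q) ->
  schur_stable A.
Proof.
move=> q1 hq; rewrite /schur_stable /spectral_radius; set E := [set _ | _ in _].
(* Without eigenvalues, as in dimension 0, [sup] takes the value 0, which is below 1. *)
have [->|/set0P E0] := eqVneq E set0; first by rewrite sup0.
apply: le_lt_trans q1; apply: ge_sup => // _ [z ez <-].
by rewrite Re_normE; apply: hq.
Qed.

Lemma schur_stable_trmx n (A : 'M[R]_n) : schur_stable A -> schur_stable A^T.
Proof.
move=> sA; apply: (normc_schur_stable sA) => z.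
rewrite -map_trmx eigenvalue_trmx; exact: normc_le_spectral_radius.
Qed.

Lemma schur_stable_pow_bound n (A : 'M[R]_n) : schur_stable A ->
  exists q C, [/\ 0 <= q, q < 1 & forall k i j, `|(A ^+ k) i j| <= C * q ^+ k].
Proof.
move=> sA; have [|q [C [q0 q1 hC]]] := complex_pow_bound (B := map_mx (real_complex R) A).
  by move=> z /normc_le_spectral_radius/le_lt_trans; apply.
exists q, C; split=> // k i j.
have powE : (map_mx (real_complex R) A) ^+ k = map_mx (real_complex R) (A ^+ k).
  elim: k => [|k IH]; first by rewrite !expr0 map_mx1.
  by rewrite !exprS IH map_mxM.
by have := hC k i j; rewrite powE mxE normc_real.
Qed.

End SchurStable.

(** * Discrete Lyapunov equations *)

Section Lyapunov.
Context {R : realType} {n : nat}.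
Implicit Types (A X W S : 'M[R]_n).

Lemma le0_geometric (a C q : R) :
  0 <= q -> q < 1 -> (forall k, a <= C * q ^+ k) -> a <= 0.
Proof.
move=> q0 q1 h; have cv : (fun k => C * q ^+ k) @ \oo --> C * 0.
  by apply: cvgMr; apply: cvg_expr; rewrite ger0_norm.
rewrite -(mulr0 C); apply: (ler_cvg_to (cvg_cst a) cv).
by near=> k; apply: h.
Unshelve. all: by end_near. Qed.

Lemma bil_le_l1_prod (M : 'M[R]_n) x y : `|bil M x y| <= l1 x * l1 M * l1 y.
Proof.
rewrite (le_trans (l1_entry _ 0 0)) // (le_trans (l1M _ _)) //.
by rewrite ler_wpM2r ?l1_ge0 // (le_trans (l1M _ _)) // l1_tr.
Qed.

Lemma congr_pow_bound A X x y : schur_stable A ->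
  exists q C, [/\ 0 <= q, q < 1 &
    forall k, `|bil (A ^+ k *m X *m (A ^+ k)^T) x y| <= C * q ^+ k].
Proof.
move=> /schur_stable_pow_bound[q [C [q0 q1 hC]]].
have l1k k : l1 (A ^+ k) <= (\sum_(i < n) \sum_(j < n) C) * q ^+ k.
  rewrite mulr_suml; apply: ler_sum => i _; rewrite mulr_suml.
  by apply: ler_sum => j _; apply: hC.
set D := \sum_i _ in l1k.
exists (q ^+ 2), (l1 x * (D ^+ 2 * l1 X) * l1 y); split=> [||k].
- exact: exprn_ge0.
- by rewrite expr_lt1.
rewrite (le_trans (bil_le_l1_prod _ _ _)) // [leRHS]mulrAC ler_wpM2r ?l1_ge0 //.
rewrite -[leRHS]mulrA ler_wpM2l ?l1_ge0 //.
rewrite (le_trans (l1M _ _)) // l1_tr (le_trans (ler_wpM2r _ (l1M _ _))) ?l1_ge0 //.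
have -> : D ^+ 2 * l1 X * (q ^+ 2) ^+ k = (D * q ^+ k) * l1 X * (D * q ^+ k).
  by rewrite exprAC; ring.
by rewrite ler_pM ?mulr_ge0 ?l1_ge0 // ler_wpM2r ?l1_ge0.
Qed.

(* X - A X A^T >= 0 telescopes to X >= A^k X (A^k)^T, which tends to 0. *)
Lemma lyapunov_psd A X : schur_stable A -> X^T = X ->
  psd (X - A *m X *m A^T) -> psd X.
Proof.
move=> sA sX pW; split=> // x.
have tele k : psd (X - A ^+ k *m X *m (A ^+ k)^T).
  elim: k => [|k IH].
    by rewrite expr0 trmx1 mulmx1 mul1mx subrr; apply: psd0.
  have -> : X - A ^+ k.+1 *m X *m (A ^+ k.+1)^T = (X - A *m X *m A^T)
      + A *m (X - A ^+ k *m X *m (A ^+ k)^T) *m A^T.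
    rewrite exprS -[A * _]/(A *m _) trmx_mul mulmxBr mulmxBl !mulmxA.
    by rewrite addrA subrK.
  by apply: psdD => //; apply: psd_congr.
have [q [C [q0 q1 hC]]] := congr_pow_bound X x x sA.
rewrite -oppr_le0; apply: (le0_geometric q0 q1 (C := C)) => k.
have [_ /(_ x)] := tele k; rewrite bilB subr_ge0 => hk.
apply: le_trans (hC k); rewrite ler_normr; apply/orP; right.
by rewrite lerN2.
Qed.

Lemma lyapunov_inj A X : schur_stable A -> X = A *m X *m A^T -> X = 0.
Proof.
move=> sA eX; have iter k : X = A ^+ k *m X *m (A ^+ k)^T.
  elim: k => [|k IH]; first by rewrite expr0 trmx1 mulmx1 mul1mx.
  rewrite exprS -[A * _]/(A *m _) trmx_mul [LHS]eX {1}IH.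
  by rewrite !mulmxA.
apply/matrixP => i j; rewrite mxE; apply/eqP; rewrite -normr_le0.
have [q [C [q0 q1 hC]]] := congr_pow_bound X (delta_mx i 0) (delta_mx j 0) sA.
by apply: (le0_geometric q0 q1 (C := C)) => k; have := hC k; rewrite -iter bil_delta.
Qed.

(** X - A X A^T is an injective endomorphism of a finite-dimensional space, hence surjective; its
    matrix is inverted. *)
Lemma lyapunov_exists A W : schur_stable A ->
  exists X, X = A *m X *m A^T + W.
Proof.
move=> sA.
pose f : 'M[R]_n -> 'M[R]_n := fun X => X - (mulmxr A^T \o mulmx A) X.
have flin : linear f.
  move=> a X Y; rewrite /f linearP scalerBr opprD /=.
  by rewrite !addrA; congr (_ + _); rewrite -!addrA; congr (_ + _); rewrite addrC.
pose fL := GRing.isLinear.Build R 'M[R]_n 'M[R]_n *:%R f flin.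
pose g : {linear 'M[R]_n -> 'M[R]_n} := HB.pack f fL.
have gE X : g X = X - A *m X *m A^T by [].
have uf : lin_mx g \in unitmx.
  rewrite -row_free_unit; apply: inj_row_free => v.
  rewrite -[v]vec_mxK mul_vec_lin => /eqP; rewrite mxvec_eq0 gE subr_eq0.
  by move=> /eqP/(lyapunov_inj sA)->; rewrite linear0.
exists (vec_mx (mxvec W *m invmx (lin_mx g))); set X := vec_mx _.
apply/eqP; rewrite addrC -subr_eq -gE; apply/eqP.
by apply: (can_inj mxvecK); rewrite -mul_vec_lin vec_mxK mulmxKV.
Qed.

(** Symmetry comes from uniqueness, since [sol]^T - [sol] solves the homogeneous equation. *)
Lemma lyapunov_xget A W (sol := xget 0 [set X | X = A *m X *m A^T + W]) :
  schur_stable A -> psd W ->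
  [/\ sol = A *m sol *m A^T + W, psd sol & psd (sol - W)].
Proof.
move=> sA [sW pW].
have e : sol = A *m sol *m A^T + W.
  by have := xgetPex 0 (lyapunov_exists W sA).
have ssol : sol^T = sol.
  apply/eqP; rewrite -subr_eq0; apply/eqP/(lyapunov_inj sA).
  rewrite mulmxBr mulmxBl {1 2}e linearD /= !trmx_mul trmxK sW mulmxA.
  by rewrite opprD addrACA subrr addr0.
have psol : psd sol.
  by apply: (lyapunov_psd sA) => //; rewrite {1}e addrAC subrr add0r.
by split=> //; rewrite {1}e addrK; apply: psd_congr.
Qed.

(* For an eigenvector v = a + ib of A, a^T S a + b^T S b is multiplied by the *)
(* squared modulus of the eigenvalue.                                         *)
Lemma contraction_schur_stable A S (e th : R) :
  0 < e -> psd (S - e%:M) -> 0 < th -> th <= 1 ->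
  psd ((1 - th) *: S - A *m S *m A^T) -> schur_stable A.
Proof.
move=> e0 [_ pS] th0 th1 [_ pc].
(* The form S will give |z|^2 <= 1 - th <= (1 - th / 2)^2, a bound uniform over the eigenvalues. *)
apply: (@normc_schur_stable _ _ _ (1 - th / 2)); first by lra.
case=> x y /eigenvalueP[v vA v0].
pose a : 'cV[R]_n := \col_i complex.Re (v 0 i).
pose b : 'cV[R]_n := \col_i complex.Im (v 0 i).
have vAj j : \sum_k v 0 k * real_complex R (A k j) = (x +i* y)%C * v 0 j.
  have := congr1 (fun u : 'rV[R[i]]_n => u 0 j) vA; rewrite !mxE => <-.
  by apply: eq_bigr => k _; rewrite mxE.
have Aa : A^T *m a = x *: a - y *: b.
  apply/colP => j; rewrite !mxE.
  have := congr1 (@complex.Re R) (vAj j); rewrite raddf_sum /=.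
  rewrite [X in _ = X -> _]/=; case: (v 0 j) => p q /= <-.
  apply: eq_bigr => k _; rewrite !mxE; case: (v 0 k) => s t /=; ring.
have Ab : A^T *m b = x *: b + y *: a.
  apply/colP => j; rewrite !mxE.
  have := congr1 (@complex.Im R) (vAj j); rewrite raddf_sum /=.
  rewrite [X in _ = X -> _]/=; case: (v 0 j) => p q /= <-.
  apply: eq_bigr => k _; rewrite !mxE; case: (v 0 k) => s t /=; ring.
have ab0 : a != 0 \/ b != 0.
  apply/orP; rewrite -negb_and; apply: contra v0 => /andP[/eqP a0 /eqP b0].
  apply/eqP/rowP => j; rewrite mxE.
  move/colP/(_ j): a0; move/colP/(_ j): b0; rewrite !mxE.
  by case: (v 0 j) => p q /= -> ->.
have s0 : 0 < bil S a a + bil S b b.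
  have ha : e * bil 1%:M a a <= bil S a a.
    by have := pS a; rewrite bilB bil_scalar subr_ge0.
  have hb : e * bil 1%:M b b <= bil S b b.
    by have := pS b; rewrite bilB bil_scalar subr_ge0.
  apply: (@lt_le_trans _ _ (e * (bil 1%:M a a + bil 1%:M b b))).
    rewrite pmulr_rgt0 //; case: ab0 => /bil1_gt0 h.
      by rewrite ltr_wpDr ?bil1_ge0.
    by rewrite ltr_wpDl ?bil1_ge0.
  by rewrite mulrDr lerD.
have := lerD (pc a) (pc b); rewrite addr0 !bilB !bilZ !bil_congr Aa Ab.
rewrite !(bilDl, bilDr, bilZl, bilZr) -[- (y *: b)]scaleNr !(bilDl, bilDr, bilZl, bilZr).
move: (bil S a b) (bil S b a) (bil S a a) (bil S b b) s0 => ab ba aa bb s0 h.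
have {h} : (x ^+ 2 + y ^+ 2) * (aa + bb) <= (1 - th) * (aa + bb) by lra.
rewrite ler_pM2r // => h.
have t0 : 0 <= 1 - th / 2 by lra.
apply: (@le_trans _ _ (Num.sqrt ((1 - th / 2) ^+ 2))); last first.
  by rewrite sqrtr_sqr ger0_norm.
by rewrite ler_wsqrtr // (le_trans h) //; nra.
Qed.

End Lyapunov.

(** * Perturbation of Lyapunov equations *)

Section LyapunovPerturbation.
Context {R : realType} {n : nat}.
Implicit Types (A S F : 'M[R]_n).

Lemma lyapunov_defectD A (X Y : 'M[R]_n) (a b : R) :
  (a *: X + b *: Y) - A *m (a *: X + b *: Y) *m A^T
  = a *: (X - A *m X *m A^T) + b *: (Y - A *m Y *m A^T).
Proof.
rewrite mulmxDr mulmxDl -!scalemxAr -!scalemxAl !scalerBr.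
by rewrite opprD addrACA.
Qed.

(** S is the covariance of the old loop and A the new loop, so F measures by how much S misses the
    new equation. Every claim is a comparison of defects Y - A Y A^T: that of 2 S - S' is S0 - 2 F
    >= 0, that of S' - S is F, and that of (|F| / e) S' is at least |F| I. *)
Lemma lyapunov_perturb A S S0 F (e : R) :
  0 < e -> psd (S0 - e%:M) -> psd (S - S0) -> F^T = F -> l1 F <= e / 2 ->
  S - A *m S *m A^T = S0 - F ->
  schur_stable A /\
  forall S', S'^T = S' -> S' = A *m S' *m A^T + S0 ->
    psd (2 *: S - S') /\ l1 (S' - S) <= 2 * n%:R * (l1 F / e * \tr S').
Proof.
move=> e0 pS0 pSS0 sF Fe defS.
have pF : psd ((l1 F)%:M - F) by apply: psd_l1_sub.
have pF' : psd ((l1 F)%:M + F).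
  by have := @psd_l1_sub _ _ (- F); rewrite linearN /= sF l1N opprK; apply.
have pSe : psd (S - e%:M).
  by have := psdD pSS0 pS0; rewrite addrA subrK.
have sS : S^T = S.
  by have [+ _] := pSe; rewrite linearB /= tr_scalar_mx => /(addIr (- e%:M)).
have sS0 : S0^T = S0.
  by have [+ _] := pS0; rewrite linearB /= tr_scalar_mx => /(addIr (- e%:M)).
have l1F0 := l1_ge0 F.
have sA : schur_stable A.
  have l1S0 := l1_ge0 S; have kp : 0 < 2 * (l1 S + e) by lra.
  (* With this contraction rate, the rate times S and the error F each use at most half of the
     margin S0 >= e I. *)
  have thS : e / (2 * (l1 S + e)) * l1 S <= e / 2.
    by rewrite -mulrA ler_wpM2l ?(ltW e0) // mulrC ler_pdivrMr //; lra.
  apply: (@contraction_schur_stable _ _ A S e (e / (2 * (l1 S + e)))) => //.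
  - by rewrite divr_gt0.
  - by rewrite ler_pdivrMr //; lra.
  set th := e / _ in thS *; have th0 : 0 <= th by rewrite divr_ge0 ?ltW.
  have -> : (1 - th) *: S - A *m S *m A^T = (S0 - e%:M) + ((l1 F)%:M - F)
      + th *: ((l1 S)%:M - S) + (e - l1 F - th * l1 S)%:M.
    have -> : (1 - th) *: S - A *m S *m A^T = (S - A *m S *m A^T) - th *: S.
      by rewrite scalerBl scale1r addrAC.
    rewrite defS; apply/matrixP => i j; rewrite !mxE.
    by case: (i == j); rewrite ?mulr1n ?mulr0n; ring.
  apply: psdD; last by apply: psd_scalar; lra.
  by apply: psdD; [apply: psdD | apply: psdZ => //; apply: psd_l1_sub].
split=> // S' sS' eS'.
have defS' : S' - A *m S' *m A^T = S0 by rewrite {1}eS' addrAC subrr add0r.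
split.
  apply: (lyapunov_psd sA); first by rewrite linearB linearZ /= sS sS'.
  rewrite -[- S']scaleN1r lyapunov_defectD defS defS' scaleN1r.
  have -> : 2 *: (S0 - F) - S0 =
      (S0 - e%:M) + 2 *: ((l1 F)%:M - F) + (e - 2 * l1 F)%:M.
    apply/matrixP => i j; rewrite !mxE.
    by case: (i == j); rewrite ?mulr1n ?mulr0n; ring.
  apply: psdD; last by apply: psd_scalar; lra.
  by apply: psdD => //; apply: psdZ.
rewrite -mxtraceZ; set k := l1 F / e.
have k0 : 0 <= k by rewrite divr_ge0 // ltW.
have ke : k * e = l1 F by rewrite divfK // gt_eqF.
apply: psd_sandwich_l1; apply: (lyapunov_psd sA).
- by rewrite linearD linearB linearZ /= sS sS'.
- have -> : k *: S' + (S' - S) = (k + 1) *: S' + (-1) *: S.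
    by rewrite scalerDl scale1r scaleN1r addrA.
  rewrite lyapunov_defectD defS defS'.
  have -> : (k + 1) *: S0 + -1 *: (S0 - F) = k *: (S0 - e%:M) + ((l1 F)%:M + F).
    rewrite -ke; apply/matrixP => i j; rewrite !mxE.
    by case: (i == j); rewrite ?mulr1n ?mulr0n; ring.
  by apply: psdD => //; apply: psdZ.
- by rewrite !linearB linearZ /= sS sS'.
- have -> : k *: S' - (S' - S) = (k - 1) *: S' + 1 *: S.
    by rewrite scalerBl !scale1r opprB addrA addrAC.
  rewrite lyapunov_defectD defS defS'.
  have -> : (k - 1) *: S0 + 1 *: (S0 - F) = k *: (S0 - e%:M) + ((l1 F)%:M - F).
    rewrite -ke; apply/matrixP => i j; rewrite !mxE.
    by case: (i == j); rewrite ?mulr1n ?mulr0n; ring.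
  by apply: psdD => //; apply: psdZ.
Qed.

End LyapunovPerturbation.

(** * The cost of a single plant *)

Section Plant.
Context {R : realType} {T : topologicalType} {N L n m : nat}.
Context (D : lpv R T N L n m) (s : 'I_L).
Context (Q_pd : posdef (costQ D)) (R_pd : posdef (costR D)).
Context (S0_pd : posdef (Sigma0 D)).
Implicit Types (K : 'M[R]_(m, n)).
Local Notation Acl := (closed_loop D s).
Local Notation P := (value_mx D s).
Local Notation X := (covar_mx D s).

Lemma value_mxP K : stabilizes D s K ->
  P K = (Acl K)^T *m P K *m Acl K + costQ D + K^T *m costR D *m K /\ psd (P K).
Proof.
move=> sK; have pW : psd (costQ D + K^T *m costR D *m K).
  apply: psdD; first exact: posdef_psd.
  by rewrite -{2}[K]trmxK; apply/psd_congr/posdef_psd.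
have -> : P K = xget 0 [set Y | Y = (Acl K)^T *m Y *m (Acl K)^T^T
                                  + (costQ D + K^T *m costR D *m K)].
  by congr xget; apply: eq_set => Y; rewrite trmxK addrA.
have [e pP _] := lyapunov_xget (schur_stable_trmx sK) pW.
by split=> //; rewrite {1}e trmxK addrA.
Qed.

Lemma covar_mxP K : stabilizes D s K ->
  [/\ X K = Acl K *m X K *m (Acl K)^T + Sigma0 D, psd (X K) &
      psd (X K - Sigma0 D)].
Proof. by move=> sK; apply: lyapunov_xget => //; apply: posdef_psd. Qed.

Lemma trace_Sigma0 K (Y : 'M[R]_n) : stabilizes D s K ->
  \tr (Y *m Sigma0 D) = \tr (Y *m X K) - \tr ((Acl K)^T *m Y *m Acl K *m X K).
Proof.
move=> sK; have [e _ _] := covar_mxP sK.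
have -> : \tr ((Acl K)^T *m Y *m Acl K *m X K)
        = \tr (Y *m (Acl K *m X K *m (Acl K)^T)).
  by rewrite !mulmxA [RHS]mxtrace_mulC !mulmxA.
by rewrite -linearB /= -mulmxBr {1}e addrAC subrr add0r.
Qed.

(** Substituting Sigma0 = X - A_cl X A_cl^T moves the Lyapunov operator from the covariance onto P,
    where it produces Q + K^T R K. *)
Lemma plant_cost_dual K : stabilizes D s K ->
  plant_cost D s K = \tr (costQ D *m X K) + \tr (K^T *m costR D *m K *m X K).
Proof.
move=> sK; have [e _] := value_mxP sK.
rewrite /plant_cost (trace_Sigma0 _ sK) {1}e !mulmxDl !linearD /=.
by rewrite [LHS]addrC !addrA addNr add0r.
Qed.

Lemma Emx_closed_loop K :
  Emx D s K = costR D *m K - (plantB D s)^T *m P K *m Acl K.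
Proof.
rewrite /Emx /Hmx /closed_loop mulmxDl mulmxBr !mulmxA opprB.
by rewrite addrA.
Qed.

(** Both costs are written as traces against the covariance at K + Dl: the new one by duality, the
    old one through [trace_Sigma0] at the new gain. Inserting the equation of P at K and expanding
    leaves exactly the linear and quadratic terms. *)
Lemma plant_cost_diff K Dl : stabilizes D s K -> stabilizes D s (K + Dl) ->
  plant_cost D s (K + Dl) - plant_cost D s K =
  2 * \tr (Dl^T *m Emx D s K *m X (K + Dl))
  + \tr (Dl^T *m Hmx D s K *m Dl *m X (K + Dl)).
Proof.
move=> sK sK'; have [eP [sP _]] := value_mxP sK.
have [_ [sX' _] _] := covar_mxP sK'; have [sR _] := R_pd.
rewrite (plant_cost_dual sK') {1}/plant_cost (trace_Sigma0 _ sK').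
have -> : Acl (K + Dl) = Acl K - plantB D s *m Dl.
  by rewrite /closed_loop mulmxDr opprD addrA.
rewrite [X in _ - (\tr (X *m _) - _)]eP Emx_closed_loop /Hmx.
move: sP sX' sR; move: (Acl K) (plantB D s) (costR D) (P K) (X (K + Dl)).
move=> A B R0 P0 X' sP sX' sR.
(* The cross terms come in transposed pairs with equal traces, hence the factor 2. *)
have symE : \tr (K^T *m R0 *m Dl *m X') = \tr (Dl^T *m R0 *m K *m X').
  rewrite -mxtrace_tr !trmx_mul trmxK sX' sR mxtrace_mulC.
  by rewrite !mulmxA.
have symF : \tr (A^T *m P0 *m B *m Dl *m X') = \tr (Dl^T *m B^T *m P0 *m A *m X').
  rewrite -mxtrace_tr !trmx_mul trmxK sX' sP mxtrace_mulC.
  by rewrite !mulmxA.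
have trN (Y : 'M[R]_n) : \tr (- Y) = - \tr Y by rewrite linearN.
have eK : (K + Dl)^T = K^T + Dl^T by rewrite linearD.
have eA : (A - B *m Dl)^T = A^T - Dl^T *m B^T by rewrite linearB /= trmx_mul.
rewrite eK eA.
rewrite !(mulmxDl, mulmxDr, mulNmx, mulmxN) !mulmxA !mxtraceD !trN.
rewrite symE symF; ring.
Qed.

End Plant.

(** * Bounds and expansion of a plant cost, uniform on sublevel sets *)

Section PlantEstimates.
Context {R : realType} {T : topologicalType} {N L n m : nat}.
Context (D : lpv R T N L n m) (s : 'I_L).
Context (Q_pd : posdef (costQ D)) (R_pd : posdef (costR D)).
Context (S0_pd : posdef (Sigma0 D)).
Implicit Types (K : 'M[R]_(m, n)).
Local Notation Acl := (closed_loop D s).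
Local Notation P := (value_mx D s).
Local Notation X := (covar_mx D s).

(** The cost dominates tr P through Sigma0, tr X through Q, and |K|^2 through R together with X >=
    Sigma0. *)
Lemma plant_bounds (c : R) : exists C, 0 < C /\ forall K,
  stabilizes D s K -> plant_cost D s K <= c ->
  [/\ l1 (P K) <= C, l1 (X K) <= C, \tr (X K) <= C & l1 K <= C].
Proof.
have [e0 e0p pS0] := posdef_margin S0_pd.
have [eQ eQp pQ] := posdef_margin Q_pd.
have [eR eRp pR] := posdef_margin R_pd.
(* The summand 1 in [cK] makes cK <= cK^2, so that a bound on |K|^2 yields one on |K| without a
   square root. *)
pose cP := `|c| / e0; pose cX := `|c| / eQ; pose cK := 1 + `|c| / (e0 * eR).
have cP0 : 0 <= cP by rewrite divr_ge0 // ltW.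
have cX0 : 0 <= cX by rewrite divr_ge0 // ltW.
have cK1 : 1 <= cK by rewrite lerDl divr_ge0 // mulr_ge0 // ltW.
have cK0 : 0 <= cK by rewrite (le_trans ler01).
have nn0 : 0 <= 2 * n%:R :> R by rewrite mulr_ge0.
have nP0 : 0 <= 2 * n%:R * cP := mulr_ge0 nn0 cP0.
have nX0 : 0 <= 2 * n%:R * cX := mulr_ge0 nn0 cX0.
have nK0 : 0 <= (m * n)%:R * cK := mulr_ge0 (ler0n _ _) cK0.
exists (1 + 2 * n%:R * cP + 2 * n%:R * cX + cX + (m * n)%:R * cK).
split=> [|K sK leKc]; first by lra.
have {leKc} leKc : plant_cost D s K <= `|c| by rewrite (le_trans leKc) ?ler_norm.
have [eP pP] := value_mxP Q_pd R_pd sK; have [eX pX pXS] := covar_mxP S0_pd sK.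
have trP : \tr (P K) <= cP.
  by rewrite ler_pdivlMr // mulrC (le_trans (trace_mul_ge pP pS0)).
have dual := plant_cost_dual Q_pd R_pd S0_pd sK.
have psdKRK : psd (K^T *m costR D *m K).
  by rewrite -{2}[K]trmxK; apply/psd_congr/posdef_psd.
have trX : \tr (X K) <= cX.
  rewrite ler_pdivlMr // mulrC (le_trans (trace_mul_ge pX pQ)) //.
  by rewrite (le_trans _ leKc) // dual mxtrace_mulC lerDl psd_trace_mul.
have trK : \tr (K^T *m K) <= cK ^+ 2.
  have h1 : e0 * \tr (K^T *m costR D *m K) <= `|c|.
    have pX0 : psd (X K - e0%:M) by have := psdD pXS pS0; rewrite addrA subrK.
    rewrite (le_trans (trace_mul_ge psdKRK pX0)) // (le_trans _ leKc) // dual.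
    by rewrite lerDr psd_trace_mul //; apply: posdef_psd.
  have h2 : eR * \tr (K^T *m K) <= \tr (K^T *m costR D *m K).
    have := psd_trace_ge0 (psd_congr K^T pR); rewrite trmxK mulmxBr mulmxBl.
    by rewrite linearB /= mul_mx_scalar -scalemxAl linearZ subr_ge0.
  apply: (@le_trans _ _ cK); last by rewrite expr2 ler_peMl.
  apply: (@le_trans _ _ (`|c| / (e0 * eR))); last by rewrite /cK lerDr.
  rewrite ler_pdivlMr ?mulr_gt0 // mulrC -mulrA (le_trans _ h1) //.
  by rewrite ler_wpM2l // ltW.
have lP := psd_l1 pP; have lX := psd_l1 pX; have lK := l1_le_fro cK0 trK.
have {lP} lP : l1 (P K) <= 2 * n%:R * cP.
  by rewrite (le_trans lP) // ler_wpM2l // mulr_ge0.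
have {lX} lX : l1 (X K) <= 2 * n%:R * cX.
  by rewrite (le_trans lX) // ler_wpM2l // mulr_ge0.
move: lP lX trX lK nP0 nX0 nK0 cX0.
move: (cX) (2 * n%:R * cP) (2 * n%:R * cX) ((m * n)%:R * cK) => t p q r.
by move=> *; split; lra.
Qed.

(** [lyapunov_perturb] shows that a small change of gain keeps the loop stable and moves the
    covariance by O(Dl); [plant_cost_diff] then becomes a second order expansion. *)
Lemma plant_expansion (c : R) : exists d C, [/\ 0 < d, 0 <= C & forall K,
  stabilizes D s K -> plant_cost D s K <= c ->
  l1 (Emx D s K *m X K) <= C /\ forall Dl, l1 Dl <= d ->
    stabilizes D s (K + Dl) /\
    `|plant_cost D s (K + Dl) - plant_cost D s K
      - 2 * \tr (Dl^T *m (Emx D s K *m X K))| <= C * l1 Dl ^+ 2].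
Proof.
have [C0 [C0p bnd]] := plant_bounds c.
have [e e0 pS0] := posdef_margin S0_pd.
set B := plantB D s; pose a := l1 (plantA D s); pose b := l1 B.
have a0 : 0 <= a := l1_ge0 _; have b0 : 0 <= b := l1_ge0 _.
have r0 : 0 <= l1 (costR D) := l1_ge0 _; have C00 := ltW C0p.
(* [c2] bounds the closed loop, [c3] and [c4] bound the Lyapunov error and the change of covariance
   per unit of [l1 Dl], [h] and [E0] bound [Hmx] and [Emx]. *)
pose c2 := a + b * C0; have c20 : 0 <= c2 by rewrite addr_ge0 ?mulr_ge0.
pose c3 := 2 * (b * C0 * c2) + b * C0 * b.
have c30 : 0 <= c3 by rewrite addr_ge0 ?mulr_ge0.
pose c4 := 2 * n%:R * (c3 / e * (2 * C0)).
have c40 : 0 <= c4 by rewrite !mulr_ge0 ?invr_ge0 // ltW.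
pose h := l1 (costR D) + b * C0 * b; have h0 : 0 <= h by rewrite addr_ge0 ?mulr_ge0.
pose E0 := h * C0 + b * C0 * a; have E00 : 0 <= E0 by rewrite addr_ge0 ?mulr_ge0.
(* The bound 1 absorbs the quadratic part of the Lyapunov error; the other keeps that error below e
   / 2. *)
pose d := Num.min 1 (e / (2 * (c3 + 1))).
have c31 : 0 < 2 * (c3 + 1) by lra.
pose k1 := 2 * (E0 * c4); have k10 : 0 <= k1 := mulr_ge0 (ler0n _ _) (mulr_ge0 E00 c40).
pose k2 := h * (2 * n%:R * (2 * C0)); have k20 : 0 <= k2 by rewrite mulr_ge0 // mulr_ge0 // mulr_ge0.
have k30 : 0 <= E0 * C0 := mulr_ge0 E00 C00.
exists d, (E0 * C0 + k1 + k2); split=> [||K sK leKc].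
- by rewrite lt_min ltr01 divr_gt0.
- by lra.
have [lP lX tX lK] := bnd _ sK leKc.
have [eX pX pXS] := covar_mxP S0_pd sK.
have sX : (X K)^T = X K by case: pX.
have lB : l1 B <= b by [].
have lBt : l1 B^T <= b by rewrite l1_tr.
have lAcl : l1 (Acl K) <= c2.
  by rewrite (le_trans (l1B _ _)) // lerD // l1M_le.
have lAclt : l1 (Acl K)^T <= c2 by rewrite l1_tr.
have lH : l1 (Hmx D s K) <= h.
  by rewrite (le_trans (l1D _ _)) // lerD // !l1M_le.
have lE : l1 (Emx D s K) <= E0.
  by rewrite (le_trans (l1B _ _)) // lerD // !l1M_le.
split; first by rewrite (@le_trans _ _ (E0 * C0)) ?l1M_le //; lra.
move=> Dl; rewrite le_min => /andP[d1 d2].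
set dl := l1 Dl in d1 d2 *; have dl0 : 0 <= dl := l1_ge0 _.
have lBD : l1 (B *m Dl) <= b * dl by apply: l1M_le.
have lBDt : l1 (B *m Dl)^T <= b * dl by rewrite l1_tr.
pose A' := Acl (K + Dl).
have A'E : A' = Acl K - B *m Dl.
  by rewrite /A' /closed_loop mulmxDr opprD addrA.
pose F := A' *m X K *m A'^T - Acl K *m X K *m (Acl K)^T.
have FE : F = B *m Dl *m X K *m (B *m Dl)^T - B *m Dl *m X K *m (Acl K)^T
    - Acl K *m X K *m (B *m Dl)^T.
  have tE : (Acl K - B *m Dl)^T = (Acl K)^T - (B *m Dl)^T by rewrite linearB.
  rewrite /F A'E tE; move: (B *m Dl) (Acl K) => U V.
  rewrite !mulmxBl !mulmxBr.
  move: (V *m X K *m V^T) (U *m X K *m V^T) (V *m X K *m U^T) (U *m X K *m U^T).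
  by move=> p q r t; apply/matrixP => i j; rewrite !mxE; ring.
have lF : l1 F <= c3 * dl.
  rewrite FE (le_trans (l1B _ _)) // (le_trans (lerD (l1B _ _) (lexx _))) //.
  apply: (@le_trans _ _ (b * dl * C0 * (b * dl) + b * dl * C0 * c2 + c2 * C0 * (b * dl))).
    by rewrite !lerD // !l1M_le.
  have -> : c3 * dl = b * dl * C0 * b + b * dl * C0 * c2 + c2 * C0 * (b * dl).
    by rewrite /c3; ring.
  by rewrite !lerD // ler_wpM2l ?mulr_ge0 // ler_piMr.
have sF : F^T = F.
  by rewrite /F linearB /= !trmx_mul !trmxK sX !mulmxA.
have lFe : l1 F <= e / 2.
  rewrite (le_trans lF) // (le_trans (ler_wpM2l c30 d2)) //.
  rewrite mulrA ler_pdivrMr //; nra.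
have defX : X K - A' *m X K *m A'^T = Sigma0 D - F.
  by rewrite /F opprB addrCA {1}eX addrA addrC; congr (_ + _); rewrite addrC addrA addNr add0r.
have [sK' pert] := lyapunov_perturb e0 pS0 pXS sF lFe defX.
split=> //; have [eX' pX' _] := covar_mxP S0_pd sK'.
have [pXX' lXX'] := pert _ (proj1 pX') eX'.
set X' := X (K + Dl) in eX' pX' pXX' lXX' *.
have trX' : \tr X' <= 2 * C0.
  have := psd_trace_ge0 pXX'; rewrite linearB linearZ /= subr_ge0 => /le_trans; apply.
  by rewrite ler_wpM2l.
have lX' : l1 X' <= 2 * n%:R * (2 * C0).
  by rewrite (le_trans (psd_l1 pX')) // ler_wpM2l // mulr_ge0.
have {lXX'} lXX' : l1 (X' - X K) <= c4 * dl.
  rewrite (le_trans lXX') //.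
  have -> : c4 * dl = 2 * n%:R * (c3 * dl / e * (2 * C0)) by rewrite /c4; ring.
  rewrite ler_wpM2l ?mulr_ge0 // ler_pM ?psd_trace_ge0 ?divr_ge0 ?l1_ge0 ?(ltW e0) //.
  by rewrite ler_wpM2r // invr_ge0 ltW.
rewrite (plant_cost_diff Q_pd R_pd S0_pd sK sK') -/X'.
(* Two errors remain, both quadratic in [dl]: replacing the new covariance by the old one in the
   linear term ([k1]) and the quadratic term itself ([k2]). *)
have -> : 2 * \tr (Dl^T *m Emx D s K *m X')
    + \tr (Dl^T *m Hmx D s K *m Dl *m X') - 2 * \tr (Dl^T *m (Emx D s K *m X K))
  = 2 * \tr (Dl^T *m Emx D s K *m (X' - X K)) + \tr (Dl^T *m Hmx D s K *m Dl *m X').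
  rewrite mulmxA; move: (Dl^T *m Emx D s K) (\tr (_ *m Hmx D s K *m _ *m _)) => Y t.
  by rewrite mulmxBr linearB /= mulrBr addrAC.
have lDt : l1 Dl^T <= dl by rewrite l1_tr.
rewrite (le_trans (ler_normD _ _)) // normrM ger0_norm //.
have t1 : `|\tr (Dl^T *m Emx D s K *m (X' - X K))| <= dl * E0 * (c4 * dl).
  by rewrite (le_trans (l1_trace _)) // !l1M_le.
have t2 : `|\tr (Dl^T *m Hmx D s K *m Dl *m X')| <= dl * h * dl * (2 * n%:R * (2 * C0)).
  by rewrite (le_trans (l1_trace _)) // !l1M_le.
apply: (@le_trans _ _ (k1 * dl ^+ 2 + k2 * dl ^+ 2)).
  rewrite lerD //.
    by rewrite (le_trans (ler_wpM2l _ t1)) // le_eqVlt /k1; apply/orP; left; apply/eqP; ring.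
  by rewrite (le_trans t2) // le_eqVlt /k2; apply/orP; left; apply/eqP; ring.
rewrite -mulrDl ler_wpM2r ?sqr_ge0 // -addrA lerDr.
exact: k30.
Qed.

End PlantEstimates.

(** * The scheduled cost *)

Section ScheduleExpansion.
Context {R : realType} {T : topologicalType} {N L n m : nat}.
Context (D : lpv R T N L n m).
Context (nu_gt0 : forall s : 'I_L, 0 < nu D s).
Context (wt_ge0 : forall (i : 'I_N) (r : T), 0 <= wt D i r).
Context (wt_sum1 : forall r : T, \sum_(i < N) wt D i r = 1).
Context (Q_pd : posdef (costQ D)) (R_pd : posdef (costR D)).
Context (S0_pd : posdef (Sigma0 D)).
Implicit Types (KK V W : schedule R N n m) (s : 'I_L).

Lemma inner_ge0 V : 0 <= inner V V.
Proof. by apply: sumr_ge0 => i _; apply: fro_ge0. Qed.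

Lemma inner_eq0 V : inner V V <= 0 -> forall i, V i = 0.
Proof.
move=> h i; apply: fro_eq0; rewrite (le_trans _ h) // /inner (bigD1 i) //=.
by rewrite lerDl sumr_ge0 // => j _; apply: fro_ge0.
Qed.

Lemma deployedD KK V s :
  deployed D (fun i => KK i + V i) s = deployed D KK s + deployed D V s.
Proof. by rewrite -big_split; apply: eq_bigr => i _; rewrite scalerDr. Qed.

Lemma deployedB KK V s :
  deployed D (fun i => KK i - V i) s = deployed D KK s - deployed D V s.
Proof.
by rewrite -sumrB; apply: eq_bigr => i _; rewrite scalerBr.
Qed.

(** The plantwise form of the linear term: with [Kst] = [KK] it is the one of [cost_expansion], with
    the minimizer the one of [cost_gap]. *)
Lemma inner_star_grad Kst KK V : inner (star_grad D Kst KK) V =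
  \sum_s nu D s * (2 * \tr ((deployed D V s)^T
    *m (Emx D s (deployed D KK s) *m covar_mx D s (deployed D Kst s)))).
Proof.
have trC (Y Z : 'M[R]_(m, n)) : \tr (Y^T *m Z) = \tr (Z^T *m Y).
  by rewrite -mxtrace_tr trmx_mul trmxK.
under [RHS]eq_bigr => s _.
  rewrite trC /deployed mulmx_sumr linear_sum /= mulr_sumr mulr_sumr.
  over.
rewrite exchange_big; apply: eq_bigr => i _; rewrite trC /star_grad.
rewrite -scalemxAr linearZ mulmx_sumr linear_sum /= mulr_sumr.
apply: eq_bigr => s _; rewrite -!scalemxAr !linearZ /= trC; ring.
Qed.

Lemma l1_deployed V s (r : R) : 0 <= r -> inner V V <= r ^+ 2 ->
  l1 (deployed D V s) <= (N * (m * n))%:R * r.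
Proof.
move=> r0 hr; have wle1 i : wt D i (rho D s) <= 1.
  by rewrite -(wt_sum1 (rho D s)) (bigD1 i) //= lerDl sumr_ge0.
have h i : l1 (wt D i (rho D s) *: V i) <= (m * n)%:R * r.
  rewrite l1Z ger0_norm // (@le_trans _ _ (1 * l1 (V i))) ?ler_wpM2r ?l1_ge0 //.
  rewrite mul1r l1_le_fro // (le_trans _ hr) // /inner (bigD1 i) //= lerDl.
  by rewrite sumr_ge0 // => j _; apply: fro_ge0.
rewrite (le_trans (l1_sum _ _)) // (le_trans (ler_sum _ (fun i _ => h i))) //.
by rewrite sumr_const card_ord [(N * _)%:R]natrM -mulrA -[leLHS]mulr_natl.
Qed.

Lemma plant_cost_ge0 s (K : 'M[R]_(m, n)) : stabilizes D s K -> 0 <= plant_cost D s K.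
Proof.
by move=> /(value_mxP Q_pd R_pd)[_ pP]; apply: psd_trace_mul => //; apply: posdef_psd.
Qed.

Lemma plant_cost_le KK c s : feasible D KK -> cost D KK <= c ->
  plant_cost D s (deployed D KK s) <= c / nu D s.
Proof.
move=> fK leKc; rewrite ler_pdivlMr // mulrC (le_trans _ leKc) //.
rewrite /cost (bigD1 s) //= lerDl sumr_ge0 // => s' _.
by rewrite mulr_ge0 ?plant_cost_ge0 // ltW.
Qed.

(** Each plant has cost at most c / nu_s, so its constants depend only on c; the smallest of the
    finitely many radii serves all plants. *)
Lemma cost_expansion (c : R) : exists d C, [/\ 0 < d, 0 <= C & forall KK,
  feasible D KK -> cost D KK <= c ->
  inner (star_grad D KK KK) (star_grad D KK KK) <= C /\
  forall V, inner V V <= d ->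
    feasible D (fun i => KK i + V i) /\
    `|cost D (fun i => KK i + V i) - cost D KK - inner (star_grad D KK KK) V|
      <= C * inner V V].
Proof.
have /choice[dC hdC] := fun s => plant_expansion s Q_pd R_pd S0_pd (c / nu D s).
have /choice[CC hCC] := hdC.
pose d := \big[Order.min/1]_s dC s.
have d0 : 0 < d by apply: lt_bigmin => // s _; have [] := hCC s.
have led s : d <= dC s by apply: bigmin_le_cond.
have CC0 s : 0 <= CC s by have [] := hCC s.
have nu0 s : 0 <= nu D s by rewrite ltW.
pose k : R := (N * (m * n))%:R; have k0 : 0 <= k by [].
pose CE := \sum_s nu D s * CC s.
have CE0 : 0 <= CE by apply: sumr_ge0 => s _; apply: mulr_ge0.
have k1 : 0 < k + 1 by rewrite ltr_wpDl.
pose CG : R := N%:R * (2 * CE) ^+ 2.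
have CG0 : 0 <= CG by rewrite mulr_ge0 // sqr_ge0.
(* The radius is squared because [inner V V] is a squared norm; k + 1 avoids dividing by zero. *)
exists ((d / (k + 1)) ^+ 2), (CG + CE * k ^+ 2); split=> [||KK fK leKc].
- by rewrite exprn_gt0 // divr_gt0.
- by rewrite addr_ge0 // mulr_ge0 // sqr_ge0.
have hs s := let: And3 _ _ h := hCC s in h _ (fK s) (plant_cost_le s fK leKc).
split.
  apply: (@le_trans _ _ CG); last by rewrite lerDl mulr_ge0 // sqr_ge0.
  rewrite /CG mulr_natl -[X in _ *+ X](card_ord N) -sumr_const.
  apply: ler_sum => i _; rewrite (le_trans (fro_le_l1 _)) //.
  rewrite ler_sqr ?nnegrE ?l1_ge0 ?mulr_ge0 // /star_grad l1Z ger0_norm //.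
  rewrite ler_wpM2l // (le_trans (l1_sum _ _)) //; apply: ler_sum => s _.
  have wle1 : wt D i (rho D s) <= 1.
    by rewrite -(wt_sum1 (rho D s)) (bigD1 i) //= lerDl sumr_ge0.
  rewrite l1Z ger0_norm ?mulr_ge0 // -mulrA ler_wpM2l //.
  by rewrite -[leRHS]mul1r ler_pM ?l1_ge0 //; case: (hs s).
move=> V hV; pose r := Num.sqrt (inner V V).
have r0 : 0 <= r by apply: sqrtr_ge0.
have r2 : r ^+ 2 = inner V V by rewrite sqr_sqrtr ?inner_ge0.
have rd : r <= d / (k + 1).
  by rewrite -ler_sqr ?nnegrE // ?r2 // divr_ge0 // ltW.
have l1V s : l1 (deployed D V s) <= k * r by apply: l1_deployed; rewrite ?r2.
have kr : k * r <= d.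
  rewrite ler_pdivlMr // in rd; rewrite (le_trans _ rd) // mulrC.
  by rewrite ler_wpM2l // lerDl.
have hV' s := (hs s).2 (deployed D V s) (le_trans (l1V s) (le_trans kr (led s))).
split; first by move=> s; rewrite /stabilizes deployedD; case: (hV' s).
rewrite inner_star_grad /cost -!sumrB (le_trans (ler_norm_sum _ _ _)) //.
apply: (@le_trans _ _ (CE * k ^+ 2 * inner V V)); last first.
  by rewrite ler_wpM2r ?inner_ge0 // lerDr.
rewrite -mulrA mulr_suml; apply: ler_sum => s _.
rewrite deployedD -!mulrBr normrM ger0_norm // -mulrA ler_wpM2l //.
have [_ /le_trans] := hV' s; apply; rewrite ler_wpM2l // -r2 -exprMn.
by rewrite ler_sqr ?nnegrE ?l1_ge0 ?mulr_ge0.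
Qed.

End ScheduleExpansion.

(** * The gradient formula and the decrease along a gradient step *)

Lemma derive1_quadratic (R : realType) (f : R -> R) (g C d : R) :
  0 < d -> 0 <= C -> (forall h, h ^+ 2 <= d -> `|f h - f 0 - h * g| <= C * h ^+ 2) ->
  derive1 f 0 = g.
Proof.
move=> d0 C0 hf; apply: cvg_lim => //; apply/cvgrPdist_le => e e0.
pose r := Num.min 1 (Num.min d (e / (C + 1))).
have C1 : 0 < C + 1 by lra.
have r0 : 0 < r by rewrite !lt_min ltr01 d0 divr_gt0.
near=> h.
have h0 : h != 0 by near: h; apply: nbhs_dnbhs_neq.
have hr : `|h| <= r.
  near: h; apply: nbhs_dnbhs; apply/nbhs_ballP; exists r => //= h.
  by rewrite /ball /= sub0r normrN => /ltW.
move: hr; rewrite !le_min => /and3P[h1 hd hC].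
have hh : h ^+ 2 <= d.
  by rewrite -real_normK ?num_real // expr2 (le_trans _ hd) // ler_piMr.
rewrite addr0 distrC -[X in _ - X]mul1r -(mulVf h0) -mulrA -mulrBr normrM normfV.
rewrite mulrC ler_pdivrMr ?normr_gt0 // (le_trans (hf _ hh)) //.
rewrite -real_normK ?num_real // expr2 mulrA ler_wpM2r //.
rewrite ler_pdivlMr // in hC; rewrite (le_trans _ hC) // mulrC ler_wpM2l //.
by rewrite lerDl.
Unshelve. all: by end_near. Qed.

Section Descent.
Context {R : realType} {T : topologicalType} {N L n m : nat}.
Context (D : lpv R T N L n m).
Context (nu_gt0 : forall s : 'I_L, 0 < nu D s).
Context (wt_ge0 : forall (i : 'I_N) (r : T), 0 <= wt D i r).
Context (wt_sum1 : forall r : T, \sum_(i < N) wt D i r = 1).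
Context (Q_pd : posdef (costQ D)) (R_pd : posdef (costR D)).
Context (S0_pd : posdef (Sigma0 D)).
Implicit Types (KK V W : schedule R N n m) (s : 'I_L).

(** The expansion in each coordinate direction determines the partial derivatives by which [grad] is
    defined. *)
Lemma gradE KK : feasible D KK -> grad D KK = star_grad D KK KK.
Proof.
move=> fK; have [d [C [d0 C0 hC]]] :=
  cost_expansion nu_gt0 wt_ge0 wt_sum1 Q_pd R_pd S0_pd (cost D KK).
have [_ {}hC] := hC KK fK (lexx _).
apply: funext => i; apply/matrixP => a b; rewrite mxE.
pose f t := cost D (fun j => if j == i then KK j + t *: delta_mx a b else KK j).
apply: (@derive1_quadratic _ f _ _ _ d0 C0) => h hh.
pose V : schedule R N n m := fun j => if j == i then h *: delta_mx a b else 0.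
have fh : f h = cost D (fun j => KK j + V j).
  by congr (cost D _); apply: funext => j; rewrite /V; case: ifP; rewrite ?addr0.
have f0 : f 0 = cost D KK.
  by congr (cost D _); apply: funext => j; rewrite scale0r addr0 if_same.
have V2 (W : schedule R N n m) : inner W V = h * W i a b.
  rewrite /inner (bigD1 i) //= big1 ?addr0 => [|j ji]; last first.
    by rewrite /V (negbTE ji) mulmx0 mxtrace0.
  rewrite /V eqxx -scalemxAr mxtraceZ; congr (_ * _).
  rewrite fro_sum (bigD1 a) //= (bigD1 b) //= mxE !eqxx mulr1.
  rewrite !big1 ?addr0 // => [j ja|j jb]; last by rewrite mxE (negbTE jb) andbF mulr0.
  by apply: big1 => l _; rewrite mxE (negbTE ja) mulr0.
have VV : inner V V = h ^+ 2.
  by rewrite V2 /V eqxx !mxE !eqxx mulr1.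
have [|_] := hC V; first by rewrite VV.
by rewrite VV V2 fh f0.
Qed.

(** The expansion along -eta g bounds the new cost by J - eta |g|^2 + C eta^2 |g|^2; half of the
    decrease survives as long as C eta <= 1/2. *)
Lemma uniform_descent (c : R) : exists2 eb : R, 0 < eb & forall KK (eta : R),
  feasible D KK -> cost D KK <= c -> 0 <= eta -> eta <= eb ->
  feasible D (gd_step D eta KK) /\
  cost D (gd_step D eta KK) <= cost D KK - eta / 2 * inner (grad D KK) (grad D KK).
Proof.
have [d [C [d0 C0 hC]]] := cost_expansion nu_gt0 wt_ge0 wt_sum1 Q_pd R_pd S0_pd c.
have C1 : 0 < C + 1 by lra.
have C2 : 0 < 2 * (C + 1) by lra.
(* The first two bounds, with |g|^2 <= C, keep eta^2 |g|^2 <= d, where the expansion is valid; the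
   third gives eta C <= 1/2. *)
exists (Num.min 1 (Num.min (d / (C + 1)) (2 * (C + 1))^-1)).
  by rewrite !lt_min ltr01 divr_gt0 // invr_gt0.
move=> KK eta fK leKc eta0; rewrite !le_min => /and3P[e1 ed eC].
have [gC {}hC] := hC KK fK leKc.
rewrite (gradE fK); set g := star_grad D KK KK in gC hC *.
pose V : schedule R N n m := fun i => - eta *: g i.
have inV W : inner W V = - eta * inner W g.
  rewrite /inner mulr_sumr; apply: eq_bigr => i _.
  by rewrite /V -scalemxAr mxtraceZ.
have VV : inner V V = eta ^+ 2 * inner g g.
  rewrite inV /inner !mulr_sumr; apply: eq_bigr => i _.
  have -> : (V i)^T = - eta *: (g i)^T by rewrite /V linearZ.
  by rewrite -scalemxAl mxtraceZ; ring.
have stepE : gd_step D eta KK = (fun i => KK i + V i).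
  by apply: funext => i; rewrite /gd_step (gradE fK) /V scaleNr.
have g0 := inner_ge0 g.
have [|fV] := hC V.
  rewrite VV; rewrite ler_pdivlMr // in ed; rewrite (le_trans _ ed) //.
  apply: (@le_trans _ _ (eta * inner g g)).
    by rewrite ler_wpM2r // expr2 ler_piMr.
  by rewrite ler_wpM2l // (le_trans gC) // lerDl.
rewrite VV inV stepE => h; split=> //.
have {}eC : eta * C <= 1 / 2.
  have := eC; rewrite -[X in _ <= X]mul1r ler_pdivlMr // => eC'; nra.
move: h; rewrite ler_norml => /andP[_ h].
have : C * (eta ^+ 2 * inner g g) <= 1 / 2 * (eta * inner g g).
  have -> : C * (eta ^+ 2 * inner g g) = eta * C * (eta * inner g g) by ring.
  by rewrite ler_wpM2r // mulr_ge0.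
lra.
Qed.

End Descent.

(** * Gradient dominance and convergence *)

Section GradientDominance.
Context {R : realType} {T : topologicalType} {N L n m : nat}.
Context (D : lpv R T N L n m).
Context (nu_gt0 : forall s : 'I_L, 0 < nu D s).
Context (Q_pd : posdef (costQ D)) (R_pd : posdef (costR D)).
Context (S0_pd : posdef (Sigma0 D)) (Gw_pd : posdef (Gw D)).
Context (Kst : schedule R N n m) (Kst_feas : feasible D Kst).
Implicit Types (KK V W : schedule R N n m) (s : 'I_L).
Local Notation dist KK := (fun i => KK i - Kst i).

(** [plant_cost_diff] from [KK] towards [Kst]: the covariance that occurs is the one at the
    minimizer, which explains the starred gradient. *)
Lemma cost_gap KK : feasible D KK ->
  cost D KK - cost D Kst = inner (star_grad D Kst KK) (dist KK) - QH D Kst KK.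
Proof.
move=> fK; rewrite inner_star_grad /QH /cost -!sumrB; apply: eq_bigr => s _.
rewrite -!mulrBr deployedB; congr (_ * _).
set K := deployed D KK s; set K' := deployed D Kst s.
have sK : stabilizes D s K := fK s.
have sK' : stabilizes D s (K + (K' - K)) by rewrite addrC subrK; apply: Kst_feas.
have := plant_cost_diff Q_pd R_pd S0_pd sK sK'; rewrite [K + _]addrC subrK.
rewrite -[K' - K]opprB; set Dl := K - K'.
have -> : (- Dl)^T = - Dl^T by rewrite linearN.
have trN (Y : 'M[R]_n) : \tr (- Y) = - \tr Y by rewrite linearN.
rewrite !mulNmx !mulmxN !trN !mulNmx trN opprK => h.
rewrite -opprB h -[covar_mx D s K' *m _ *m _ *m _]mulmxA -[covar_mx D s K' *m _ *m _]mulmxA.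
by rewrite [\tr (covar_mx D s K' *m _)]mxtrace_mulC !mulmxA; ring.
Qed.

Lemma Gw_quadratic (x : 'cV[R]_N) :
  bil (Gw D) x x = \sum_s nu D s * (\sum_i wt D i (rho D s) * x i 0) ^+ 2.
Proof.
rewrite /Gw bil_sum; apply: eq_bigr => s _; rewrite bilZ bil_outer expr2.
congr (_ * (_ * _)); rewrite mxE; apply: eq_bigr => i _; rewrite !mxE //.
by rewrite mulrC.
Qed.

(** For each matrix position (a, b), the entries of the N gains form a vector on which the average
    over the grid is the quadratic form of [Gw]. *)
Lemma deployed_coercive V : (0 < N)%N ->
  lambda_min (Gw D) * inner V V <=
  \sum_s nu D s * \tr ((deployed D V s)^T *m deployed D V s).
Proof.
move=> N0; have [sG _] := Gw_pd; have [[_ pG] _] := lambda_min_spec N0 sG.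
pose x a b : 'cV[R]_N := \col_i V i a b.
have -> : \sum_s nu D s * \tr ((deployed D V s)^T *m deployed D V s)
    = \sum_a \sum_b bil (Gw D) (x a b) (x a b).
  under eq_bigr => s _ do rewrite fro_sum mulr_sumr.
  rewrite exchange_big; apply: eq_bigr => a _.
  under eq_bigr => s _ do rewrite mulr_sumr.
  rewrite exchange_big; apply: eq_bigr => b _; rewrite Gw_quadratic.
  apply: eq_bigr => s _; congr (_ * _); rewrite -expr2 /deployed summxE.
  by congr (_ ^+ 2); apply: eq_bigr => i _; rewrite !mxE.
have -> : inner V V = \sum_a \sum_b bil 1%:M (x a b) (x a b).
  rewrite /inner; under eq_bigr => i _ do rewrite fro_sum.
  rewrite exchange_big; apply: eq_bigr => a _.
  rewrite exchange_big; apply: eq_bigr => b _.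
  by rewrite bil1 mul1r; apply: eq_bigr => i _; rewrite mxE.
rewrite mulr_sumr; apply: ler_sum => a _; rewrite mulr_sumr; apply: ler_sum => b _.
by have := pG (x a b); rewrite bilB bil_scalar subr_ge0.
Qed.

(** Plant by plant, H dominates R and the covariance at the minimizer dominates Sigma0;
    [deployed_coercive] sums this up. *)
Lemma QH_coercive KK : (0 < N)%N -> (0 < n)%N -> (0 < m)%N -> feasible D KK ->
  lambda_min (Gw D) * lambda_min (Sigma0 D) * lambda_min (costR D)
    * inner (dist KK) (dist KK) <= QH D Kst KK.
Proof.
move=> N0 n0 m0 fK; have [sS _] := S0_pd; have [sR _] := R_pd.
have [pS _] := lambda_min_spec n0 sS; have [pR _] := lambda_min_spec m0 sR.
set lS := lambda_min (Sigma0 D) in pS *; set lR := lambda_min (costR D) in pR *.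
have lS0 : 0 < lS by apply: lambda_min_gt0.
have lR0 : 0 < lR by apply: lambda_min_gt0.
apply: (@le_trans _ _ (lS * lR * \sum_s nu D s *
    \tr ((deployed D (dist KK) s)^T *m deployed D (dist KK) s))).
  have -> : lambda_min (Gw D) * lS * lR * inner (dist KK) (dist KK)
      = lS * lR * (lambda_min (Gw D) * inner (dist KK) (dist KK)) by ring.
  rewrite ler_wpM2l ?mulr_ge0 ?(ltW lS0) ?(ltW lR0) //.
  exact: deployed_coercive.
rewrite /QH mulr_sumr; apply: ler_sum => s _.
rewrite deployedB mulrCA ler_wpM2l ?(ltW (nu_gt0 s)) //.
move: (deployed D KK s - deployed D Kst s) => Dl.
have [_ pP] := value_mxP Q_pd R_pd (fK s).
have [_ _ pXS] := covar_mxP S0_pd (Kst_feas s).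
have pX0 : psd (covar_mx D s (deployed D Kst s) - lS%:M).
  by have := psdD pXS pS; rewrite addrA subrK.
have pBPB : psd ((plantB D s)^T *m value_mx D s (deployed D KK s) *m plantB D s).
  by rewrite -{2}[plantB D s]trmxK; apply: psd_congr.
have pHR : psd (Hmx D s (deployed D KK s) - lR%:M).
  by have := psdD pR pBPB; rewrite addrAC.
have pH : psd (Hmx D s (deployed D KK s)) by apply: psdD => //; apply: posdef_psd.
have pDHD : psd (Dl^T *m Hmx D s (deployed D KK s) *m Dl).
  by rewrite -{2}[Dl]trmxK; apply: psd_congr.
have -> : \tr (covar_mx D s (deployed D Kst s) *m Dl^T *m Hmx D s (deployed D KK s) *m Dl)
    = \tr (Dl^T *m Hmx D s (deployed D KK s) *m Dl *m covar_mx D s (deployed D Kst s)).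
  by rewrite [RHS]mxtrace_mulC !mulmxA.
rewrite (le_trans _ (trace_mul_ge pDHD pX0)) // -mulrA ler_wpM2l ?(ltW lS0) //.
have := psd_trace_ge0 (psd_congr Dl^T pHR); rewrite trmxK mulmxBr mulmxBl.
have trB (Y Z : 'M[R]_n) : \tr (Y - Z) = \tr Y - \tr Z by rewrite linearB.
by rewrite trB mul_mx_scalar -scalemxAl mxtraceZ subr_ge0.
Qed.

Lemma cost_gap_le KK (tau0 : R) : feasible D KK -> 0 < QH D Kst KK ->
  tau D Kst KK <= tau0 ->
  cost D KK - cost D Kst <= inner (grad D KK) (dist KK) - (1 - tau0) * QH D Kst KK.
Proof.
move=> fK QH0; rewrite /tau ler_pdivrMr // (cost_gap fK).
have -> : 2 * inner (remainder D Kst KK) (dist KK)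
    = inner (star_grad D Kst KK) (dist KK) - inner (grad D KK) (dist KK).
  rewrite /inner mulr_sumr -sumrB; apply: eq_bigr => i _.
  have -> : (remainder D Kst KK i)^T
      = 2^-1 *: ((star_grad D Kst KK i)^T - (grad D KK i)^T).
    by rewrite /remainder linearZ linearB.
  by rewrite -scalemxAl mxtraceZ mulrA divff // mul1r mulmxBl linearB.
move: (inner _ _) (inner _ _) (QH D Kst KK) => p q r; lra.
Qed.

End GradientDominance.

(** * Convergence of schedules and invariance of the component *)

Section Topology.
Context {R : realType} {N n m : nat}.

Lemma schedule_cvg (S : Type) (F : set_system S) (f : S -> schedule R N n m)
    (g : schedule R N n m) : Filter F ->
  (forall i, (fun t => f t i) @ F --> g i) -> f @ F --> g.
Proof.
move=> FF h; apply/cvg_sup => i A /=.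
rewrite (@nbhsE (initial_topology (fun f : 'I_N -> 'M[R]_(m, n) => f i))) /=.
move=> [B [[C oC <-] Cg] sBA].
have : nbhs (g i) C by apply: open_nbhs_nbhs.
move=> /(h i) hC; apply: (@filterS _ F FF ((fun t => f t i) @^-1` C)) => //.
by move=> t Ct; apply: sBA.
Qed.

End Topology.

Section GradientIteration.
Context {R : realType} {T : topologicalType} {N L n m : nat}.
Context (D : lpv R T N L n m).
Implicit Types (KK V W : schedule R N n m).

Lemma gd_step_continuous KK : continuous (fun eta : R => gd_step D eta KK).
Proof.
move=> eta; apply: schedule_cvg => i; apply: cvgB; first exact: cvg_cst.
by apply: cvgZr_tmp; apply: cvg_id.
Qed.

(** The steps of size h in [0, eta] trace a connected segment from [KK] inside the sublevel set. *)
Lemma Gcomp_gd_step Kst KK (c eta : R) : 0 <= eta ->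
  (forall h, 0 <= h -> h <= eta ->
    feasible D (gd_step D h KK) /\ cost D (gd_step D h KK) <= c) ->
  Gcomp D Kst c KK -> Gcomp D Kst c (gd_step D eta KK).
Proof.
move=> eta0 hstep GK; apply: (connected_component_trans GK).
apply: (@connected_component_max _ _ ((fun h => gd_step D h KK) @` `[0, eta])).
- exists 0; first by rewrite /= in_itv /= lexx eta0.
  by apply: funext => i; rewrite /gd_step scale0r subr0.
- by move=> _ [h /= + <-]; rewrite in_itv /= => /andP[h0 h1]; apply: hstep.
- apply: connected_continuous_connected; first exact: segment_connected.
  by apply: continuous_subspaceT; apply: gd_step_continuous.
- by exists eta => //=; rewrite in_itv /= lexx eta0.
Qed.

(** Used with V the gradient and W the displacement from the minimizer. Expanding |V - 2 k W|^2 >= 0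
    gives the first bound, |V - k W|^2 >= 0 the second. *)
Lemma inner_dominance V W (k gap : R) : 0 < k ->
  0 <= gap -> gap <= inner V W - k * inner W W ->
  4 * k * gap <= inner V V /\ k ^+ 2 * inner W W <= inner V V.
Proof.
move=> k0 gap0 hgap.
have sq (a : R) : 0 <= inner V V - 2 * a * inner V W + a ^+ 2 * inner W W.
  have -> : inner V V - 2 * a * inner V W + a ^+ 2 * inner W W
    = inner (fun i => V i - a *: W i) (fun i => V i - a *: W i).
    rewrite /inner !mulr_sumr -sumrB -big_split; apply: eq_bigr => i _ /=.
    rewrite !fro_sum !mulr_sumr -sumrB -big_split; apply: eq_bigr => p _ /=.
    rewrite !mulr_sumr -sumrB -big_split; apply: eq_bigr => q _ /=.
    by rewrite !mxE; ring.
  exact: inner_ge0.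
have := sq k; have := sq (2 * k).
move: (inner V V) (inner V W) (inner W W) hgap => p q r hgap h2 h1.
by split; nra.
Qed.

End GradientIteration.

Theorem theorem2 (R : realType) (T : topologicalType) (N L n m : nat)
    (D : lpv R T N L n m)
    (nu_gt0 : forall s : 'I_L, 0 < nu D s)
    (nu_sum1 : \sum_(s < L) nu D s = 1)
    (wt_cont : forall i : 'I_N, continuous (wt D i))
    (wt_ge0 : forall (i : 'I_N) (r : T), 0 <= wt D i r)
    (wt_sum1 : forall r : T, \sum_(i < N) wt D i r = 1)
    (Q_pd : posdef (costQ D))
    (R_pd : posdef (costR D))
    (Sigma0_pd : posdef (Sigma0 D))
    (feas_neq0 : feasible D !=set0)
    (Gw_pd : posdef (Gw D))
    (Kstar : schedule R N n m)
    (Kstar_min : is_minimizer D Kstar) :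
  exists etabar : set (schedule R N n m) -> R,
    forall c tau0 : R,
      cost D Kstar < c -> tau0 < 1 ->
      (forall K : schedule R N n m, Gcomp D Kstar c K -> K <> Kstar ->
         tau D Kstar K <= tau0) ->
      let mu := 4 * (1 - tau0) * lambda_min (Gw D) * lambda_min (Sigma0 D)
                  * lambda_min (costR D) in
      0 < etabar (Gcomp D Kstar c) /\
      forall (K0 : schedule R N n m) (eta : R),
        Gcomp D Kstar c K0 ->
        0 < eta -> eta <= etabar (Gcomp D Kstar c) ->
        [/\ forall t : nat, Gcomp D Kstar c (gd_iter D eta K0 t),
            forall t : nat,
              cost D (gd_iter D eta K0 t) - cost D Kstar
                <= (1 - eta * mu / 2) ^+ t * (cost D K0 - cost D Kstar)
          & gd_iter D eta K0 @ \oo --> Kstar].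
Proof.
have [fst cst_min] := Kstar_min.
(* This property of eb mentions only the set G, neither c nor tau0. *)
pose descent (G : set (schedule R N n m)) (eb : R) := 0 < eb /\
  forall K eta, G K -> 0 <= eta -> eta <= eb ->
    feasible D (gd_step D eta K) /\
    cost D (gd_step D eta K) <= cost D K - eta / 2 * inner (grad D K) (grad D K).
(* The step bound must be a function of the set alone, so it is chosen by [xget] from [descent]; the
   default 1 is never reached on the component, where [uniform_descent] supplies a witness. *)
exists (fun G => xget 1 [set eb | descent G eb]) => c tau0 ltc lt1 htau mu.
set G := Gcomp D Kstar c; set eb := xget _ _.
have Gsub K : G K -> feasible D K /\ cost D K <= c.
  by move=> GK; have := connected_component_sub GK.
have [eb0 hdesc] : descent G eb.
  apply: (xgetPex 1).
  have [eb' eb'0 h] := uniform_descent nu_gt0 wt_ge0 wt_sum1 Q_pd R_pd Sigma0_pd c.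
  exists eb'; split; first exact: eb'0.
  by move=> K eta GK; have [fK leKc] := Gsub K GK; exact: h K eta fK leKc.
split=> // K0 eta GK0 eta0 leeta.
have Gstep K : G K -> G (gd_step D eta K).
  move=> GK; apply: (Gcomp_gd_step (ltW eta0) _ GK) => h h0 hle.
  have [fh ch] := hdesc K h GK h0 (le_trans hle leeta).
  split=> //; rewrite (le_trans ch) // (le_trans _ (proj2 (Gsub _ GK))) //.
  by rewrite gerBl mulr_ge0 ?inner_ge0 // divr_ge0.
have Giter t : G (gd_iter D eta K0 t) by elim: t => //= t IH; apply: Gstep.
(* If m n = 0 there is only one schedule. Otherwise both dimensions are positive, as the lemmas on
   [lambda_min] require. *)
have [mn0|] := posnP (m * n).
  have eqK (K K' : schedule R N n m) : K = K'.
    apply: funext => i; apply/matrixP => a b; exfalso; move/eqP: mn0.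
    rewrite muln_eq0 => /orP[/eqP e|/eqP e].
      by have := ltn_ord a; rewrite [X in (_ < X)%N]e.
    by have := ltn_ord b; rewrite [X in (_ < X)%N]e.
  split=> // [t|]; first by rewrite (eqK (gd_iter D eta K0 t) Kstar) (eqK K0 Kstar) subrr mulr0.
  have -> : gd_iter D eta K0 = (fun=> Kstar) by apply: funext => t; apply: eqK.
  exact: cvg_cst.
rewrite muln_gt0 => /andP[m0 n0].
(* The nu_s sum to 1, so there is a grid point, and the weights sum to 1 there. *)
have N0 : (0 < N)%N.
  rewrite lt0n; apply/negP => /eqP N0.
  have [s _] : exists s : 'I_L, true.
    apply: contrapT => h; move: nu_sum1; rewrite big1 => [/eqP|s _].
      by rewrite eq_sym oner_eq0.
    by exfalso; apply: h; exists s.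
  move: (wt_sum1 (rho D s)); rewrite big1 => [/eqP|i _].
    by rewrite eq_sym oner_eq0.
  by have := ltn_ord i; rewrite [X in (_ < X)%N]N0.
pose lam := lambda_min (Gw D) * lambda_min (Sigma0 D) * lambda_min (costR D).
have lam0 : 0 < lam by rewrite !mulr_gt0 ?lambda_min_gt0.
pose k := (1 - tau0) * lam.
have k0 : 0 < k by rewrite mulr_gt0 // subr_gt0.
have muE : mu = 4 * k by rewrite /mu /k /lam; ring.
have dom K : G K -> let g := inner (grad D K) (grad D K) in
    mu * (cost D K - cost D Kstar) <= g /\
    k ^+ 2 * inner (fun i => K i - Kstar i) (fun i => K i - Kstar i) <= g.
  move=> GK /=; have [fK _] := Gsub _ GK; rewrite muE.
  have gap0 : 0 <= cost D K - cost D Kstar by rewrite subr_ge0 cst_min.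
  (* The bound on [tau] excludes the minimizer itself, where both left-hand sides vanish. *)
  have [->|KK] := pselect (K = Kstar).
    have -> : inner (fun i => Kstar i - Kstar i) (fun i => Kstar i - Kstar i) = 0 :> R.
      by rewrite /inner big1 // => i _; rewrite subrr mulmx0 mxtrace0.
    by rewrite subrr !mulr0 inner_ge0.
  have dd0 : 0 < inner (fun i => K i - Kstar i) (fun i => K i - Kstar i).
    rewrite ltNge; apply/negP => /inner_eq0 h; apply: KK; apply: funext => i.
    by apply/eqP; rewrite -subr_eq0 h.
  have QHge := QH_coercive nu_gt0 Q_pd R_pd Sigma0_pd Gw_pd fst N0 n0 m0 fK.
  have QH0 : 0 < QH D Kstar K by rewrite (lt_le_trans _ QHge) // mulr_gt0.
  have gap := cost_gap_le Q_pd R_pd Sigma0_pd fst fK QH0 (htau K GK KK).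
  apply: (inner_dominance k0 gap0); rewrite (le_trans gap) // lerB //.
  by rewrite /k -mulrA ler_wpM2l // subr_ge0 ltW.
pose J t := cost D (gd_iter D eta K0 t) - cost D Kstar.
have J0 t : 0 <= J t by rewrite subr_ge0; exact: cst_min (proj1 (Gsub _ (Giter t))).
have Jstep t : J t.+1 <= J t - eta / 2 *
    inner (grad D (gd_iter D eta K0 t)) (grad D (gd_iter D eta K0 t)).
  have [_ h] := hdesc _ _ (Giter t) (ltW eta0) leeta.
  by rewrite /J addrAC lerD2r.
have Jrate t : J t.+1 <= (1 - eta * mu / 2) * J t.
  have [h _] := dom _ (Giter t); rewrite (le_trans (Jstep t)) //.
  have -> : (1 - eta * mu / 2) * J t = J t - eta / 2 * (mu * J t) by ring.
  by rewrite lerD2l lerN2 ler_wpM2l // divr_ge0 // ltW.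
(* The sign of the contraction factor is not known yet; truncating at 0 allows the one-step bound to
   be iterated. *)
pose q := Num.max 0 (1 - eta * mu / 2).
have q0 : 0 <= q by rewrite le_max lexx.
have q1 : q < 1.
  by rewrite gt_max ltr01 /= gtrBl divr_gt0 // mulr_gt0 // muE mulr_gt0.
have leq : 1 - eta * mu / 2 <= q by rewrite le_max lexx orbT.
have Jq t : J t <= q ^+ t * J 0.
  elim: t => [|t IH]; first by rewrite expr0 mul1r.
  apply: (le_trans (Jrate t)); apply: (le_trans (ler_wpM2r (J0 t) leq)).
  by rewrite exprS -mulrA ler_wpM2l.
split=> // [t|].
  (* If J 0 > 0, then 0 <= J 1 <= (1 - eta mu / 2) J 0 makes the factor nonnegative, so it equals
     [q]; if J 0 = 0, every later gap is 0. *)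
  have [J00|J00] := eqVneq (J 0) 0.
    by rewrite -/(J t) -[cost D K0 - _]/(J 0) J00 mulr0; have := Jq t; rewrite J00 mulr0.
  have rate0 : 0 <= 1 - eta * mu / 2.
    have J0p : 0 < J 0 by rewrite lt_def J00 J0.
    by rewrite -(pmulr_lge0 _ J0p) (le_trans (J0 1)) // Jrate.
  have -> : 1 - eta * mu / 2 = q by rewrite /q; apply/esym/max_idPr.
  exact: Jq.
(* As J (t+1) >= 0, the decrease gives |g|^2 <= (2 / eta) J t, and [dom] bounds k^2 times the
   squared distance by |g|^2. *)
pose M := 2 / eta / k ^+ 2 * J 0.
have dist_le t : inner (fun i => gd_iter D eta K0 t i - Kstar i)
    (fun i => gd_iter D eta K0 t i - Kstar i) <= M * q ^+ t.
  have [_] := dom _ (Giter t); have := le_trans (J0 t.+1) (Jstep t).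
  rewrite subr_ge0; move: (inner _ _) (inner (grad _ _) _) => d g hg hd.
  have {}hg : g <= 2 / eta * J t.
    by rewrite mulrAC ler_pdivlMr // ; move: hg; rewrite mulrAC ler_pdivrMr //; lra.
  have -> : M * q ^+ t = 2 / eta * (q ^+ t * J 0) / k ^+ 2.
    by rewrite /M; ring.
  rewrite ler_pdivlMr ?exprn_gt0 // mulrC (le_trans hd) // (le_trans hg) //.
  by rewrite ler_wpM2l // divr_ge0 // ltW.
apply: schedule_cvg => i; apply/cvg_ballP => e e0.
have cvM : (fun t => M * q ^+ t) @ \oo --> M * 0.
  by apply: cvgMr; apply: cvg_expr; rewrite ger0_norm.
rewrite mulr0 in cvM.
near=> t; split; [exact: e0|move=> a b]; rewrite /ball /= -ltr_sqr ?nnegrE ?(ltW e0) //.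
rewrite real_normK ?num_real // -sqrrN opprB.
apply: (@le_lt_trans _ _ (M * q ^+ t)).
  rewrite (le_trans _ (dist_le t)) // /inner (bigD1 i) //=.
  apply: (@le_trans _ _ (\tr ((gd_iter D eta K0 t i - Kstar i)^T
      *m (gd_iter D eta K0 t i - Kstar i)))).
    by have := fro_entry (gd_iter D eta K0 t i - Kstar i) a b; rewrite !mxE.
  by rewrite lerDl sumr_ge0 // => j _; apply: fro_ge0.
near: t; apply: (cvgr_lt (0 : R)) => //.
by rewrite exprn_gt0.
Unshelve. all: by end_near. Qed.
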